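(* Let $k,\ell$ be positive integers and let $\mu_1,\nu_1\in\mathcal{D}_{\mathrm{alg}}(k)$, $\mu_2,\nu_2\in\mathcal{D}_{\mathrm{alg}}(\ell)$, where $\mu_1,\mu_2$ are tracial. Consider the free product $$(\mu_1,\nu_1)\star_c(\mu_2,\nu_2)=(\widetilde{\mu},\widetilde{\nu})\in\mathcal{D}_{\mathrm{alg}}(k+\ell)\times\mathcal{D}_{\mathrm{alg}}(k+\ell).$$ Then one has $$(\mu_1,\Psi_k(\nu_1))\star_B(\mu_2,\Psi_\ell(\nu_2))=(\widetilde{\mu},\Psi_{k+\ell}(\widetilde{\nu}))\in\mathcal{D}_{\mathrm{alg}}(k+\ell)\times\mathcal{D}'_{\mathrm{alg}}(k+\ell).$$
   Context: Distributions. $\mathbb{C}\langle X_1,\ldots,X_k\rangle$ is the algebra of polynomials in non-commuting indeterminates. $\mathcal{D}_{\mathrm{alg}}(k)$ is the set of linear functionals $\mu$ on it with $\mu(1)=1$, and $\mathcal{D}'_{\mathrm{alg}}(k)$ is the set of linear functionals $\mu'$ on it with $\mu'(1)=0$. $\mu$ is tracial if $\mu(PQ)=\mu(QP)$ for all $P,Q$. Partitions. $NC(n)$ is the set of non-crossing partitions of $\{1,\ldots,n\}$; $\mathrm{Int}(n)\subseteq NC(n)$ is the set of interval partitions (every block is a set of consecutive integers). A block $V$ of $\pi\in NC(n)$ is inner if there is a block $W$ of $\pi$ with $\min W<\min V\le\max V<\max W$; otherwise it is outer. For $M=\{i_1<\cdots<i_m\}\subseteq\{1,\ldots,n\}$,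 $(x_1,\ldots,x_n)\mid M:=(x_{i_1},\ldots,x_{i_m})$. Cumulants. Let $\mathcal{A}=\mathbb{C}\langle X_1,\ldots,X_k\rangle$, let $\mu,\nu\in\mathcal{D}_{\mathrm{alg}}(k)$ and $\mu'\in\mathcal{D}'_{\mathrm{alg}}(k)$. The following families of multilinear functionals $\mathcal{A}^n\to\mathbb{C}$, $n\ge1$, are uniquely determined by the stated identities, required for all $n\geq 1$ and $x_1,\ldots,x_n\in\mathcal{A}$. - Free cumulants $\kappa_{n;\mu}$ of $\mu$: $\mu(x_1\cdots x_n)=\sum_{\pi\in NC(n)}\prod_{V\in\pi}\kappa_{|V|;\mu}((x_1,\ldots,x_n)\mid V)$. - Boolean cumulants $\beta_{n;\nu}$ of $\nu$: $\nu(x_1\cdots x_n)=\sum_{\pi\in \mathrm{Int}(n)}\prod_{V\in\pi}\beta_{|V|;\nu}((x_1,\ldots,x_n)\mid V)$. - c-free cumulants $\kappa^{(c)}_{n;(\mu,\nu)}$ of $(\mu,\nu)$: $\nu(x_1\cdots x_n)=\sum_{\pi\in NC(n)}\prod_{V\in\pi\text{ inner}}\kappa_{|V|;\mu}((x_1,\ldots,x_n)\mid V)\prod_{W\in\pi\text{ outer}}\kappa^{(c)}_{|W|;(\mu,\nu)}((x_1,\ldots,x_n)\mid W)$. - Infinitesimal free cumulants $\kappa'_{n;(\mu,\mu')}$ of $(\mu,\mu')$: $\mu'(x_1\cdots x_n)=\sum_{\pi\in NC(n)}\sum_{V_o\in\pi}\kappa'_{|V_o|;(\mu,\mu')}((x_1,\ldots,x_n)\mid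 V_o)\prod_{V\in\pi, V\ne V_o}\kappa_{|V|;\mu}((x_1,\ldots,x_n)\mid V)$. The map $\Psi_k:\mathcal{D}_{\mathrm{alg}}(k)\to\mathcal{D}'_{\mathrm{alg}}(k)$. For $\nu\in\mathcal{D}_{\mathrm{alg}}(k)$, $\Psi_k(\nu)=\mu'$ is the functional in $\mathcal{D}'_{\mathrm{alg}}(k)$ determined by $\mu'(X_{i_1}\cdots X_{i_n})=\sum_{m=1}^n\beta_{n+1;\nu}(X_{i_m},\ldots,X_{i_n},X_{i_1},\ldots,X_{i_m})$ for all $n\ge1$ and $i_1,\ldots,i_n\in\{1,\ldots,k\}$. Free products. For $\mu_1\in\mathcal{D}_{\mathrm{alg}}(k)$ and $\mu_2\in\mathcal{D}_{\mathrm{alg}}(\ell)$, the free product $\mu_1\star\mu_2$ is the unique $\widetilde{\mu}\in\mathcal{D}_{\mathrm{alg}}(k+\ell)$ such that for all $n\ge1$ and $i_1,\ldots,i_n\in\{1,\ldots,k+\ell\}$: $\kappa_{n;\widetilde\mu}(X_{i_1},\ldots,X_{i_n})$ equals $\kappa_{n;\mu_1}(X_{i_1},\ldots,X_{i_n})$ if all $i_j\le k$; equals $\kappa_{n;\mu_2}(X_{i_1-k},\ldots,X_{i_n-k})$ if all $i_j>k$; and equals $0$ otherwise. For $\mu_1,\nu_1\in\mathcal{D}_{\mathrm{alg}}(k)$, $\mu_2,\nu_2\in\mathcal{D}_{\mathrm{alg}}(\ell)$, the c-free product is $(\mu_1,\nu_1)\star_c(\mu_2,\nu_2):=(\widetilde\mu,\widetilde\nu)$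 with $\widetilde\mu=\mu_1\star\mu_2$ and $\widetilde\nu\in\mathcal{D}_{\mathrm{alg}}(k+\ell)$ the unique distribution such that $\kappa^{(c)}_{n;(\widetilde\mu,\widetilde\nu)}(X_{i_1},\ldots,X_{i_n})$ equals $\kappa^{(c)}_{n;(\mu_1,\nu_1)}(X_{i_1},\ldots,X_{i_n})$ if all $i_j\le k$, equals $\kappa^{(c)}_{n;(\mu_2,\nu_2)}(X_{i_1-k},\ldots,X_{i_n-k})$ if all $i_j>k$, and $0$ otherwise. For $\mu_1\in\mathcal{D}_{\mathrm{alg}}(k)$, $\mu_1'\in\mathcal{D}'_{\mathrm{alg}}(k)$, $\mu_2\in\mathcal{D}_{\mathrm{alg}}(\ell)$, $\mu_2'\in\mathcal{D}'_{\mathrm{alg}}(\ell)$, the infinitesimal free product is $(\mu_1,\mu_1')\star_B(\mu_2,\mu_2'):=(\widetilde\mu,\widetilde\mu')$ with $\widetilde\mu=\mu_1\star\mu_2$ and $\widetilde\mu'\in\mathcal{D}'_{\mathrm{alg}}(k+\ell)$ the unique functional such that $\kappa'_{n;(\widetilde\mu,\widetilde\mu')}(X_{i_1},\ldots,X_{i_n})$ equals $\kappa'_{n;(\mu_1,\mu_1')}(X_{i_1},\ldots,X_{i_n})$ if all $i_j\le k$, equals $\kappa'_{n;(\mu_2,\mu_2')}(X_{i_1-k},\ldots,X_{i_n-k})$ if all $i_j>k$, and $0$ otherwise. *)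

(* Defs.v *)
From HB Require Import structures.
From mathcomp Require Import all_boot all_order all_algebra.
From mathcomp Require Import finmap boolp reals complex monalg.
Set Implicit Arguments.
Unset Strict Implicit.
Unset Printing Implicit Defensive.
Import GRing.Theory.
Local Open Scope ring_scope.

Definition ncpoly (R : realType) (k : nat) := {malg R[i][{fmonom 'I_k}]}.

Definition ncX (R : realType) (k : nat) (i : 'I_k) : ncpoly R k :=
  mkmalgU (fmu i) 1.

Record Dalg (R : realType) (k : nat) := MkDalg {
  Dalg_fun :> {scalar ncpoly R k};
  Dalg_fun1 : Dalg_fun 1 = 1 }.

Record Dalg' (R : realType) (k : nat) := MkDalg' {
  Dalg'_fun :> {scalar ncpoly R k};
  Dalg'_fun1 : Dalg'_fun 1 = 0 }.

Definition tracial (R : realType) (k : nat) (mu : Dalg R k) :=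
  forall p q : ncpoly R k, mu (p * q) = mu (q * p).

Definition noncrossing n (P : {set {set 'I_n}}) :=
  [forall V in P, forall W in P, (V != W) ==>
    ~~ [exists a in V, exists b in W, exists c in V, exists d in W,
          [&& (a < b)%N, (b < c)%N & (c < d)%N]]].

Definition NC n : {set {set {set 'I_n}}} :=
  [set P | partition P setT && noncrossing P].

Definition interval_partition n : {set {set {set 'I_n}}} :=
  [set P : {set {set 'I_n}} | partition P setT &&
     [forall V in P, forall a in V, forall c in V, forall b : 'I_n,
        (a <= b <= c)%N ==> (b \in V)]].

(* Only used for nonempty V, where the default n plays no role. *)
Definition block_min n (V : {set 'I_n}) : nat := \big[minn/n]_(i in V) i.
Definition block_max n (V : {set 'I_n}) : nat := \max_(i in V) i.

Definition inner n (P : {set {set 'I_n}}) (V : {set 'I_n}) :=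
  [exists W in P, [&& (block_min W < block_min V)%N,
                      (block_min V <= block_max V)%N &
                      (block_max V < block_max W)%N]].

(* The tuple (x_1, ..., x_n) | V; enum lists V in increasing order. *)
Definition restr (T : Type) n (x : n.-tuple T) (V : {set 'I_n}) : seq T :=
  [seq tnth x i | i <- enum V].

(* A family (f_n)_{n >= 1} of functionals A^n -> K is encoded as one function
   on sequences, f_n being its restriction to sequences of size n; its value
   on the empty sequence is never used. *)
Definition multilinear (K : nzRingType) (A : lmodType K) (f : seq A -> K) :=
  forall s t a x y,
    f (s ++ (a *: x + y) :: t) = a * f (s ++ x :: t) + f (s ++ y :: t).

Definition is_free_cumulants (R : realType) (k : nat) (mu : Dalg R k)
    (kappa : seq (ncpoly R k) -> R[i]) :=
  multilinear kappa /\
  forall n (x : n.-tuple (ncpoly R k)), (0 < n)%N ->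
    mu (\prod_(y <- x) y) =
    \sum_(P in NC n) \prod_(V in P) kappa (restr x V).

Definition is_boolean_cumulants (R : realType) (k : nat) (nu : Dalg R k)
    (beta : seq (ncpoly R k) -> R[i]) :=
  multilinear beta /\
  forall n (x : n.-tuple (ncpoly R k)), (0 < n)%N ->
    nu (\prod_(y <- x) y) =
    \sum_(P in interval_partition n) \prod_(V in P) beta (restr x V).

Lemma size_restr T n (x : n.-tuple T) V : size (restr x V) = #|V|.
Proof. by rewrite size_map cardE. Qed.

Lemma restr_setT T n (x : n.-tuple T) : restr x setT = x.
Proof. by rewrite /restr enum_setT -enumT map_tnth_enum. Qed.

Lemma restr_map T U (h : T -> U) n (x : n.-tuple T) V :
  restr (map_tuple h x) V = map h (restr x V).
Proof. by rewrite /restr -map_comp; apply: eq_map => i /=; rewrite tnth_map. Qed.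

(* The four moment-cumulant identities share the shape
     M (x_1, ..., x_n) = sum over P in S n of cum_term x P f kap,
   with f the unknown family and kap a known one: j marks a choice made in P
   (none for the free, boolean and c-free cumulants, the block V_o for the
   infinitesimal ones), and b P j V tells whether V is weighted by f or by
   kap. *)
Section Inversion.
Variables (K : comNzRingType) (S : forall n, {set {set {set 'I_n}}}).
Variable J : forall n, {set {set 'I_n}} -> {set {set 'I_n}}.
Variable b : forall n, {set {set 'I_n}} -> {set 'I_n} -> {set 'I_n} -> bool.
Hypothesis Spart : forall n P, P \in S n -> partition P [set: 'I_n].
Hypothesis Sfull : forall n, (0 < n)%N -> [set setT] \in S n.
Hypothesis Jfull : forall n, (0 < n)%N -> @J n [set setT] = [set setT].
Hypothesis bfull : forall n, (0 < n)%N -> @b n [set setT] setT setT.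

Definition cum_term (T : Type) n (x : n.-tuple T) (P : {set {set 'I_n}})
    (f kap : seq T -> K) : K :=
  \sum_(j in J P) \prod_(V in P)
    (if b P j V then f (restr x V) else kap (restr x V)).

Section T.
Variable T : Type.
Implicit Types f g kap : seq T -> K.

Lemma cum_term_ext n (x : n.-tuple T) (P : {set {set 'I_n}}) f g kap kap' :
    (forall V, V \in P -> f (restr x V) = g (restr x V)) ->
    (forall V, V \in P -> kap (restr x V) = kap' (restr x V)) ->
  cum_term x P f kap = cum_term x P g kap'.
Proof.
move=> fg kk; apply: eq_bigr => j _; apply: eq_bigr => V VP.
by rewrite fg // kk.
Qed.

Lemma cum_term_full n (x : n.-tuple T) f kap :
  (0 < n)%N -> cum_term x [set setT] f kap = f x.
Proof. by move=> n0; rewrite /cum_term Jfull // !big_set1 bfull // restr_setT. Qed.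

Lemma blockP n (P : {set {set 'I_n}}) V : P \in S n -> V \in P -> (0 < #|V|)%N.
Proof.
move=> /Spart /and3P[_ _ P0] VP; rewrite card_gt0.
by apply: contraNneq P0 => <-.
Qed.

Lemma block_lt n (P : {set {set 'I_n}}) V :
  P \in S n -> P != [set setT] -> V \in P -> (#|V| < n)%N.
Proof.
move=> PS PT VP; have := max_card (mem V); rewrite card_ord leq_eqVlt => /orP[/eqP Vn|//].
case/negP: PT.
have VT : V = setT.
  by apply/eqP; rewrite eqEcard subsetT cardsT card_ord Vn leqnn.
subst V; apply/eqP; apply/setP => W; rewrite inE; apply/idP/eqP => [WP|-> //].
have /and3P[_ /trivIsetP tri _] := Spart PS.
apply/eqP/negPn/negP => WT.
have := tri W setT WP VP WT; rewrite -setI_eq0 setIT => /eqP W0.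
by have := blockP PS WP; rewrite W0 cards0.
Qed.

Definition cumeq (M f kap : seq T -> K) := forall n (x : n.-tuple T),
  (0 < n)%N -> M x = \sum_(P in S n) cum_term x P f kap.

Fixpoint cumrec (M kap : seq T -> K) m s := if m is m'.+1 then
  M s - \sum_(P in S (size s) | P != [set setT])
           cum_term (in_tuple s) P (cumrec M kap m') kap else 0.

Lemma cumrec_stable M kap m m' s : (0 < size s)%N ->
  (size s <= m)%N -> (size s <= m')%N -> cumrec M kap m s = cumrec M kap m' s.
Proof.
elim: m m' s => [|m IHm] [|m'] s; try by case: (size s).
move=> s0 sm sm' /=; congr (_ - _); apply: eq_bigr => P /andP[PS PT].
apply: cum_term_ext => // V VP; have ltV := block_lt PS PT VP.
apply: IHm; rewrite size_restr ?(blockP PS VP) //.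
- by rewrite -ltnS; apply: leq_trans sm.
- by rewrite -ltnS; apply: leq_trans sm'.
Qed.

Definition cum M kap s := cumrec M kap (size s) s.

Lemma cumE M kap n (x : n.-tuple T) : (0 < n)%N ->
  cum M kap x = M x - \sum_(P in S n | P != [set setT]) cum_term x P (cum M kap) kap.
Proof.
case: n x => // m x _; rewrite /cum {1}size_tuple /=; congr (_ - _).
have E n (sn : size x = n) (y : n.-tuple T) : tval y = x ->
    \sum_(P in S (size x) | P != [set setT]) cum_term (in_tuple x) P (cumrec M kap m) kap =
    \sum_(P in S n | P != [set setT]) cum_term y P (cumrec M kap m) kap.
  subst n; move=> yx; have -> : y = in_tuple x by apply: val_inj.
  by [].
rewrite (E _ (size_tuple x) x) //.
apply: eq_bigr => P /andP[PS PT].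
apply: cum_term_ext => // V VP; have ltV := block_lt PS PT VP.
apply: cumrec_stable; rewrite size_restr ?(blockP PS VP) //.
Qed.

Lemma cum_eq M kap : cumeq M (cum M kap) kap.
Proof.
move=> n x n0; rewrite (bigD1 [set setT]) ?Sfull //= cum_term_full // cumE //.
by rewrite subrK.
Qed.

Lemma cumeq_uniq M f g kap kap' :
    (forall s, (0 < size s)%N -> kap s = kap' s) ->
    cumeq M f kap -> cumeq M g kap' ->
  forall s, (0 < size s)%N -> f s = g s.
Proof.
move=> kk Mf Mg s; have [m] := ubnP (size s); elim: m s => // m IHm s sm s0.
have := Mf _ (in_tuple s) s0; rewrite (Mg _ (in_tuple s) s0).
rewrite (bigD1 [set setT]) ?Sfull //= [RHS](bigD1 [set setT]) ?Sfull //=.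
rewrite !cum_term_full // => /esym; rewrite [X in _ + X](eq_bigr (fun P =>
  cum_term (in_tuple s) P g kap')); first by move/addIr.
move=> P /andP[PS PT]; apply: cum_term_ext => V VP.
  have ltV := block_lt PS PT VP.
  apply: IHm; rewrite size_restr ?(blockP PS VP) //.
  exact: leq_trans ltV _.
by apply: kk; rewrite size_restr (blockP PS VP).
Qed.
End T.

Lemma cum_term_map T U (h : T -> U) n (x : n.-tuple T) (P : {set {set 'I_n}}) f kap :
  cum_term (map_tuple h x) P f kap = cum_term x P (f \o map h) (kap \o map h).
Proof.
by apply: eq_bigr => j _; apply: eq_bigr => V _; rewrite restr_map.
Qed.

Lemma cumeq_map T U (h : T -> U) M f kap : cumeq M f kap ->
  cumeq (M \o map h) (f \o map h) (kap \o map h).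
Proof.
move=> Mf n x n0 /=; have := Mf n (map_tuple h x) n0 => /= ->.
by apply: eq_bigr => P _; rewrite cum_term_map.
Qed.

Section Lin.
Variable A : lmodType K.

Definition slot n (i : 'I_n) a (z x y : n.-tuple A) :=
  tnth z i = a *: tnth x i + tnth y i /\
  forall j, j != i -> tnth z j = tnth x j /\ tnth z j = tnth y j.

Lemma restr_out n (i : 'I_n) (z x : n.-tuple A) (e : seq 'I_n) :
  (forall j, j != i -> tnth z j = tnth x j) -> i \notin e ->
  map (tnth z) e = map (tnth x) e.
Proof.
move=> zx ie; apply/eq_in_map => j je; apply: zx.
by apply: contraNneq ie => <-.
Qed.

Lemma restr_in n (i : 'I_n) a (z x y : n.-tuple A) (f : seq A -> K) (V : {set 'I_n}) :
  slot i a z x y -> multilinear f -> i \in V ->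
  f (restr z V) = a * f (restr x V) + f (restr y V).
Proof.
move=> [zi zj] fl; rewrite -mem_enum /restr => iV.
move: iV (enum_uniq V) => /splitPr[e1 e2].
rewrite cat_uniq /= negb_or => /and3P[_ /andP[ie1 _] /andP[ie2 _]].
have ox := restr_out (fun j ji => (zj j ji).1).
have oy := restr_out (fun j ji => (zj j ji).2).
by rewrite !map_cat /= zi fl {1}ox // {1}ox // {1}oy // {1}oy.
Qed.

Lemma cum_term_lin n (i : 'I_n) a (z x y : n.-tuple A) (P : {set {set 'I_n}}) f kap :
  P \in S n -> slot i a z x y ->
  (forall V, V \in P -> i \in V -> 
     f (restr z V) = a * f (restr x V) + f (restr y V)) ->
  multilinear kap ->
  cum_term z P f kap = a * cum_term x P f kap + cum_term y P f kap.
Proof.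
move=> PS sl fl kl; rewrite /cum_term mulr_sumr -big_split.
have /and3P[/eqP cov tri _] := Spart PS.
have iP : i \in cover P by rewrite cov inE.
have VP := pblock_mem iP; have iV : i \in pblock P i by rewrite mem_pblock.
apply: eq_bigr => j _; rewrite !(bigD1 (pblock P i) VP) /=.
have out (u : n.-tuple A) : (forall j, j != i -> tnth z j = tnth u j) ->
   \prod_(V in P | V != pblock P i)
     (if b P j V then f (restr z V) else kap (restr z V)) =
   \prod_(V in P | V != pblock P i)
     (if b P j V then f (restr u V) else kap (restr u V)).
  move=> zu; apply: eq_bigr => V /andP[V_P Vi].
  rewrite /restr (restr_out zu) // mem_enum.
  by apply: contraNN Vi => /(def_pblock tri V_P) ->.
rewrite -(out x (fun j h => (sl.2 j h).1)) -(out y (fun j h => (sl.2 j h).2)).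
rewrite [a * _]mulrA -mulrDl; congr (_ * _); case: ifP => _; first exact: fl.
exact: restr_in sl kl iV.
Qed.

Lemma cum_lin (M kap : seq A -> K) : multilinear M -> multilinear kap ->
  multilinear (cum M kap).
Proof.
move=> Ml kl.
suff H : forall m n (i : 'I_n) a (z x y : n.-tuple A), (n < m)%N ->
    slot i a z x y -> cum M kap z = a * cum M kap x + cum M kap y.
  move=> s t a x y.
  have sz u : size (s ++ u :: t) == (size s + size t).+1.
    by rewrite size_cat addnS.
  have si : (size s < (size s + size t).+1)%N by rewrite ltnS leq_addr.
  apply: (H _ _ (Ordinal si) a (Tuple (sz (a *: x + y))) (Tuple (sz x))
    (Tuple (sz y)) (ltnSn _)); split=> [|j].
    by rewrite !(tnth_nth 0) /= !nth_cat ltnn subnn.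
  rewrite -val_eqE /= => js; rewrite !(tnth_nth 0) /= !nth_cat.
  case: ltnP => // sj; case E : (j - size s)%N => //.
  by move/eqP: E; rewrite subn_eq0 leqNgt ltn_neqAle eq_sym js sj.
elim=> // m IHm n i a z x y nm sl; have n0 : (0 < n)%N by case: n i {nm z x y sl} => [[]|].
rewrite !cumE //.
have -> : M z = a * M x + M y.
  by rewrite -{1}(restr_setT z) (restr_in sl Ml) ?inE // !restr_setT.
rewrite mulrBr mulr_sumr addrACA -opprD -big_split; congr (_ - _).
apply: eq_bigr => P /andP[PS PT]; apply: cum_term_lin => // [|V VP iV]; first exact: sl.
have ltV := block_lt PS PT VP.
have sR u : size (@restr A n u V) == #|V| by rewrite size_restr.
have iI : (index i (enum V) < #|V|)%N by rewrite cardE index_mem mem_enum.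
have tR u (j : 'I_#|V|) : tnth (Tuple (sR u)) j = tnth u (enum_val j).
  rewrite (tnth_nth 0) /= (nth_map i) -?cardE //; congr tnth.
  by rewrite (enum_val_nth i).
apply: (IHm _ (Ordinal iI) a (Tuple (sR z)) (Tuple (sR x)) (Tuple (sR y))).
  exact: leq_trans ltV _.
have ei : enum_val (Ordinal iI) = i.
  by rewrite (enum_val_nth i) /= nth_index // mem_enum.
split=> [|j jI]; rewrite !tR ?ei; first exact: sl.1.
apply: sl.2; apply: contraNneq jI => ej; apply/eqP/enum_val_inj.
by rewrite ei ej.
Qed.
End Lin.
End Inversion.

Section linext.
Variables (R : realType) (k : nat) (f : seq 'I_k -> R[i]).
Definition linext (p : ncpoly R k) : R[i] := \sum_(w <- msupp p) p@_w * f w.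
Fact linext_is_linear : scalar linext.
Proof.
have E d (g : ncpoly R k) : (msupp g `<=` d)%fset -> linext g = \sum_(w <- d) g@_w * f w.
  by move=> le; rewrite /linext -(mmapEw (f := idfun) (h := fun w : {fmonom 'I_k} => f w) le).
move=> a p q /=; pose d := (msupp (a *: p + q) `|` (msupp p `|` msupp q))%fset.
have [lp lq lpq] : [/\ msupp p `<=` d, msupp q `<=` d & msupp (a *: p + q) `<=` d]%fset.
  by split; apply/fsubsetP => w; rewrite !in_fsetU => ->; rewrite ?orbT.
rewrite !(E d) //.
rewrite mulr_sumr -big_split; apply: eq_bigr => w _ /=.
by rewrite mcoeffD mcoeffZ mulrDl mulrA.
Qed.
HB.instance Definition _ := GRing.isLinear.Build R[i] (ncpoly R k) R[i] *%R linext linext_is_linear.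
End linext.

Lemma prod_ncX (R : realType) (k : nat) (w : seq 'I_k) :
  \prod_(i <- w) ncX R i = mkmalgU (FMonom w) 1.
Proof.
elim: w => [|i w IHw]; first by rewrite big_nil -fmoneE.
by rewrite big_cons IHw malgM_def fgmulUU mulr1 /mmul /= fmmulE fmuE.
Qed.

Lemma linextE (R : realType) (k : nat) (f : seq 'I_k -> R[i]) (w : seq 'I_k) :
  linext f (\prod_(i <- w) ncX R i) = f w.
Proof.
rewrite prod_ncX.
transitivity (mmap (@idfun R[i]) (fun m : {fmonom 'I_k} => f m)
                   (mkmalgU (FMonom w) 1)); first by [].
by rewrite mmapU mul1r.
Qed.

Lemma linext1 (R : realType) (k : nat) (f : seq 'I_k -> R[i]) :
  linext f 1 = f [::].
Proof. by rewrite -linextE big_nil. Qed.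

Lemma scalar_words (R : realType) (k : nat) (f g : {scalar ncpoly R k}) :
  (forall w, f (\prod_(i <- w) ncX R i) = g (\prod_(i <- w) ncX R i)) ->
  f = g.
Proof.
move=> fg; have {}fg : f =1 g.
  move=> p; rewrite (monalgE p) !linear_sum; apply: eq_bigr => m _.
  have -> : mkmalgU m p@_m = p@_m *: mkmalgU (FMonom m) 1.
    apply/malgP => w; rewrite mcoeffZ !mcoeffU fmK.
    by case: eqP => _; rewrite ?mulr1n ?mulr0n ?mulr1 ?mulr0.
  by rewrite !linearZ -prod_ncX /= fg.
case: f g fg => [f [cf1 cf2]] [g [cg1 cg2]] /= /funext fg.
subst g; congr (GRing.Linear.Pack (GRing.Linear.Class _ _)).
  case: cf1 cg1 => [p1] [p2]; congr Algebra.isNmodMorphism.Axioms_.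
  exact: Prop_irrelevance.
case: cf2 cg2 => [p1] [p2]; congr GRing.isScalable.Axioms_.
exact: Prop_irrelevance.
Qed.

Lemma Dalg_eq (R : realType) (k : nat) (mu nu : Dalg R k) :
  (forall w, (0 < size w)%N ->
     mu (\prod_(i <- w) ncX R i) = nu (\prod_(i <- w) ncX R i)) ->
  mu = nu.
Proof.
case: mu nu => [f f1] [g g1] /= fg.
have fgE : f = g.
  by apply: scalar_words => -[|i w]; [rewrite big_nil f1 g1 | exact: fg].
by subst g; congr MkDalg; exact: Prop_irrelevance.
Qed.

Lemma Dalg'_eq (R : realType) (k : nat) (mu nu : Dalg' R k) :
  (forall w, (0 < size w)%N ->
     mu (\prod_(i <- w) ncX R i) = nu (\prod_(i <- w) ncX R i)) ->
  mu = nu.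
Proof.
case: mu nu => [f f1] [g g1] /= fg.
have fgE : f = g.
  by apply: scalar_words => -[|i w]; [rewrite big_nil f1 g1 | exact: fg].
by subst g; congr MkDalg'; exact: Prop_irrelevance.
Qed.

Lemma Dalg_ex (R : realType) (k : nat) (M : seq 'I_k -> R[i]) :
  exists mu : Dalg R k, forall w, (0 < size w)%N ->
    mu (\prod_(i <- w) ncX R i) = M w.
Proof.
pose M1 w := if w is [::] then 1 else M w.
have M11 : (linext M1 : {scalar _}) 1 = 1 by rewrite /= linext1.
by exists (MkDalg M11) => -[|i w] // _; rewrite /= linextE.
Qed.

Lemma Dalg'_ex (R : realType) (k : nat) (M : seq 'I_k -> R[i]) :
  exists mu : Dalg' R k, forall w, (0 < size w)%N ->
    mu (\prod_(i <- w) ncX R i) = M w.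
Proof.
pose M1 w := if w is [::] then 0 else M w.
have M11 : (linext M1 : {scalar _}) 1 = 0 by rewrite /= linext1.
by exists (MkDalg' M11) => -[|i w] // _; rewrite /= linextE.
Qed.

Lemma ncpoly_scalerAr (R : realType) (k : nat) (a : R[i]) (p q : ncpoly R k) :
  p * (a *: q) = a *: (p * q).
Proof.
apply/malgP => m; rewrite mcoeffZ.
rewrite (mcoeffMlw m (fsubset_refl (msupp p)) (msuppZ_le a q)).
rewrite (mcoeffMlw m (fsubset_refl (msupp p)) (fsubset_refl (msupp q))).
rewrite mulr_sumr; apply: eq_bigr => m1 _.
rewrite mulr_sumr; apply: eq_bigr => m2 _.
by rewrite mcoeffZ mulrnAr mulrCA.
Qed.

Lemma multilinear_moment (R : realType) (k : nat) (f : {scalar ncpoly R k}) :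
  multilinear (fun s : seq (ncpoly R k) => f (\prod_(y <- s) y)).
Proof.
move=> s t a x y /=; rewrite !big_cat !big_cons /=.
by rewrite mulrDl mulrDr -scalerAl ncpoly_scalerAr linearP.
Qed.

Lemma NC_part n (P : {set {set 'I_n}}) :
  P \in NC n -> partition P [set: 'I_n].
Proof. by rewrite inE => /andP[]. Qed.

Lemma interval_part n (P : {set {set 'I_n}}) :
  P \in interval_partition n -> partition P [set: 'I_n].
Proof. by rewrite inE => /andP[]. Qed.

Lemma partition_full n : (0 < n)%N -> partition [set [set: 'I_n]] setT.
Proof.
move=> n0; apply/and3P; split; first by rewrite /cover big_set1.
  by apply/trivIsetP => A B; rewrite !inE => /eqP-> /eqP->; rewrite eqxx.
by rewrite inE eq_sym -card_gt0 cardsT card_ord.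
Qed.

Lemma NC_full n : (0 < n)%N -> [set [set: 'I_n]] \in NC n.
Proof.
move=> n0; rewrite inE partition_full //=; apply/forall_inP => V.
rewrite inE => /eqP->; apply/forall_inP => W; rewrite inE => /eqP->.
by rewrite eqxx.
Qed.

Lemma interval_full n : (0 < n)%N -> [set [set: 'I_n]] \in interval_partition n.
Proof.
move=> n0; rewrite inE partition_full //=; apply/forall_inP => V.
rewrite inE => /eqP->; apply/forall_inP => a _; apply/forall_inP => c _.
by apply/forallP => b; rewrite inE implybT.
Qed.

Lemma inner_full n : ~~ inner [set [set: 'I_n]] setT.
Proof.
apply/negP => /exists_inP[W]; rewrite inE => /eqP-> /and3P[].
by rewrite ltnn.
Qed.

Definition Jone n (P : {set {set 'I_n}}) : {set {set 'I_n}} := [set setT].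
Definition Jall n (P : {set {set 'I_n}}) : {set {set 'I_n}} := P.
Definition b_all n (P : {set {set 'I_n}}) (j V : {set 'I_n}) := true.
Definition b_outer n (P : {set {set 'I_n}}) (j V : {set 'I_n}) := ~~ inner P V.
Definition b_marked n (P : {set {set 'I_n}}) (j V : {set 'I_n}) := V == j.

Section Terms.
Variables (R : realType) (T : Type) (n : nat) (x : n.-tuple T).
Implicit Types (P : {set {set 'I_n}}) (f kap : seq T -> R[i]).

Lemma term_freeE P f kap :
  cum_term Jone b_all x P f kap = \prod_(V in P) f (restr x V).
Proof. by rewrite /cum_term big_set1. Qed.

Lemma term_cfreeE P f kap : cum_term Jone b_outer x P f kap =
  (\prod_(V in P | inner P V) kap (restr x V)) *
  (\prod_(V in P | ~~ inner P V) f (restr x V)).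
Proof.
rewrite /cum_term big_set1 (bigID (inner P)) /=; congr (_ * _).
  by apply: eq_bigr => V /andP[_ iV]; rewrite /b_outer iV.
by apply: eq_bigr => V /andP[_ iV]; rewrite /b_outer iV.
Qed.

Lemma term_infE P f kap : cum_term Jall b_marked x P f kap =
  \sum_(V0 in P) f (restr x V0) * \prod_(V in P | V != V0) kap (restr x V).
Proof.
apply: eq_bigr => V0 V0P; rewrite (bigD1 V0) //= /b_marked eqxx.
by congr (_ * _); apply: eq_bigr => V /andP[_ /negPf->].
Qed.
End Terms.

Section Cumulants.
Variables (R : realType) (k : nat).
Local Notation A := (ncpoly R k).
Local Notation mom f := (fun s : seq A => f (\prod_(y <- s) y)).

Lemma is_freeE (mu : Dalg R k) (kappa : seq A -> R[i]) kap :
  is_free_cumulants mu kappa <-> multilinear kappa /\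
    cumeq NC Jone b_all (mom mu) kappa kap.
Proof.
split=> -[kl E]; split=> // n x n0; rewrite E //; apply: eq_bigr => P _;
  by rewrite term_freeE.
Qed.

Lemma is_booleanE (mu : Dalg R k) (kappa : seq A -> R[i]) kap :
  is_boolean_cumulants mu kappa <-> multilinear kappa /\
    cumeq interval_partition Jone b_all (mom mu) kappa kap.
Proof.
split=> -[kl E]; split=> // n x n0; rewrite E //; apply: eq_bigr => P _;
  by rewrite term_freeE.
Qed.

Lemma free_cumulants_exist (mu : Dalg R k) :
  exists kappa, is_free_cumulants mu kappa.
Proof.
pose kap (s : seq A) : R[i] := 0.
exists (cum NC Jone b_all (mom mu) kap); apply/(is_freeE _ _ kap); split.
  apply: cum_lin => //.
  - exact: NC_part.
  - exact: multilinear_moment.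
  - by move=> s t a x y; rewrite mulr0 addr0.
by apply: cum_eq => //; [exact: NC_part | exact: NC_full].
Qed.

Lemma boolean_cumulants_exist (nu : Dalg R k) :
  exists beta, is_boolean_cumulants nu beta.
Proof.
pose kap (s : seq A) : R[i] := 0.
exists (cum interval_partition Jone b_all (mom nu) kap).
apply/(is_booleanE _ _ kap); split.
  apply: cum_lin => //.
  - exact: interval_part.
  - exact: multilinear_moment.
  - by move=> s t a x y; rewrite mulr0 addr0.
by apply: cum_eq => //; [exact: interval_part | exact: interval_full].
Qed.

Lemma free_cumulants_uniq (mu : Dalg R k) kappa kappa' :
  is_free_cumulants mu kappa -> is_free_cumulants mu kappa' ->
  forall s, (0 < size s)%N -> kappa s = kappa' s.
Proof.
move=> /(is_freeE _ _ (fun=> 0))[_ E] /(is_freeE _ _ (fun=> 0))[_ E'].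
by apply: (cumeq_uniq _ _ _ _ _ E E') => //; [exact: NC_part | exact: NC_full].
Qed.

Lemma boolean_cumulants_uniq (nu : Dalg R k) beta beta' :
  is_boolean_cumulants nu beta -> is_boolean_cumulants nu beta' ->
  forall s, (0 < size s)%N -> beta s = beta' s.
Proof.
move=> /(is_booleanE _ _ (fun=> 0))[_ E] /(is_booleanE _ _ (fun=> 0))[_ E'].
by apply: (cumeq_uniq _ _ _ _ _ E E') => //;
  [exact: interval_part | exact: interval_full].
Qed.
End Cumulants.

Definition free_cumulant (R : realType) (k : nat) (mu : Dalg R k) :
    seq (ncpoly R k) -> R[i] :=
  sval (cid (free_cumulants_exist mu)).

Definition boolean_cumulant (R : realType) (k : nat) (nu : Dalg R k) :
    seq (ncpoly R k) -> R[i] :=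
  sval (cid (boolean_cumulants_exist nu)).

Definition is_cfree_cumulants (R : realType) (k : nat) (mu nu : Dalg R k)
    (kappac : seq (ncpoly R k) -> R[i]) :=
  multilinear kappac /\
  forall n (x : n.-tuple (ncpoly R k)), (0 < n)%N ->
    nu (\prod_(y <- x) y) =
    \sum_(P in NC n)
      (\prod_(V in P | inner P V) free_cumulant mu (restr x V)) *
      (\prod_(W in P | ~~ inner P W) kappac (restr x W)).

Definition is_inf_cumulants (R : realType) (k : nat) (mu : Dalg R k)
    (mu' : Dalg' R k) (kappa' : seq (ncpoly R k) -> R[i]) :=
  multilinear kappa' /\
  forall n (x : n.-tuple (ncpoly R k)), (0 < n)%N ->
    mu' (\prod_(y <- x) y) =
    \sum_(P in NC n) \sum_(V0 in P)
      kappa' (restr x V0) *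
      \prod_(V in P | V != V0) free_cumulant mu (restr x V).

Section Cumulants2.
Variables (R : realType) (k : nat).
Local Notation A := (ncpoly R k).
Local Notation mom f := (fun s : seq A => f (\prod_(y <- s) y)).

Lemma free_cumulantP (mu : Dalg R k) : is_free_cumulants mu (free_cumulant mu).
Proof. exact: svalP. Qed.

Lemma boolean_cumulantP (nu : Dalg R k) :
  is_boolean_cumulants nu (boolean_cumulant nu).
Proof. exact: svalP. Qed.

Lemma is_cfreeE (mu nu : Dalg R k) (kappac : seq A -> R[i]) :
  is_cfree_cumulants mu nu kappac <-> multilinear kappac /\
    cumeq NC Jone b_outer (mom nu) kappac (free_cumulant mu).
Proof.
split=> -[kl E]; split=> // n x n0; rewrite E //; apply: eq_bigr => P _;
  by rewrite term_cfreeE.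
Qed.

Lemma is_infE (mu : Dalg R k) (mu' : Dalg' R k) (kappa' : seq A -> R[i]) :
  is_inf_cumulants mu mu' kappa' <-> multilinear kappa' /\
    cumeq NC Jall b_marked (mom mu') kappa' (free_cumulant mu).
Proof.
split=> -[kl E]; split=> // n x n0; rewrite E //; apply: eq_bigr => P _;
  by rewrite term_infE.
Qed.

Lemma cfree_cumulants_exist (mu nu : Dalg R k) :
  exists kappac, is_cfree_cumulants mu nu kappac.
Proof.
exists (cum NC Jone b_outer (mom nu) (free_cumulant mu)).
apply/is_cfreeE; split.
  apply: cum_lin => //.
  - exact: NC_part.
  - exact: multilinear_moment.
  - exact: (free_cumulantP mu).1.
apply: cum_eq => //; [exact: NC_part | exact: NC_full | ].
by move=> n _; exact: inner_full.
Qed.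

Lemma inf_cumulants_exist (mu : Dalg R k) (mu' : Dalg' R k) :
  exists kappa', is_inf_cumulants mu mu' kappa'.
Proof.
exists (cum NC Jall b_marked (mom mu') (free_cumulant mu)).
apply/is_infE; split.
  apply: cum_lin => //.
  - exact: NC_part.
  - exact: multilinear_moment.
  - exact: (free_cumulantP mu).1.
apply: cum_eq => //; [exact: NC_part | exact: NC_full | ].
by move=> n _; exact: eqxx.
Qed.

Lemma cfree_cumulants_uniq (mu nu : Dalg R k) kappac kappac' :
  is_cfree_cumulants mu nu kappac -> is_cfree_cumulants mu nu kappac' ->
  forall s, (0 < size s)%N -> kappac s = kappac' s.
Proof.
move=> /is_cfreeE[_ E] /is_cfreeE[_ E'].
apply: (cumeq_uniq _ _ _ _ _ E E') => //; [exact: NC_part | exact: NC_full |].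
by move=> n _; exact: inner_full.
Qed.

Lemma inf_cumulants_uniq (mu : Dalg R k) (mu' : Dalg' R k) kappa kappa' :
  is_inf_cumulants mu mu' kappa -> is_inf_cumulants mu mu' kappa' ->
  forall s, (0 < size s)%N -> kappa s = kappa' s.
Proof.
move=> /is_infE[_ E] /is_infE[_ E'].
apply: (cumeq_uniq _ _ _ _ _ E E') => //; [exact: NC_part | exact: NC_full |].
by move=> n _; exact: eqxx.
Qed.
End Cumulants2.

Definition cfree_cumulant (R : realType) (k : nat) (mu nu : Dalg R k) :
    seq (ncpoly R k) -> R[i] :=
  sval (cid (cfree_cumulants_exist mu nu)).

Definition inf_cumulant (R : realType) (k : nat) (mu : Dalg R k)
    (mu' : Dalg' R k) : seq (ncpoly R k) -> R[i] :=
  sval (cid (inf_cumulants_exist mu mu')).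

Lemma cfree_cumulantP (R : realType) (k : nat) (mu nu : Dalg R k) :
  is_cfree_cumulants mu nu (cfree_cumulant mu nu).
Proof. exact: svalP. Qed.

Lemma inf_cumulantP (R : realType) (k : nat) (mu : Dalg R k) (mu' : Dalg' R k) :
  is_inf_cumulants mu mu' (inf_cumulant mu mu').
Proof. exact: svalP. Qed.

(* The summand of index m (counted from 0) is
   beta_(n+1) (X_(i_(m+1)), ..., X_(i_n), X_(i_1), ..., X_(i_(m+1))). *)
Definition is_Psi (R : realType) (k : nat) (nu : Dalg R k) (mu' : Dalg' R k) :=
  forall w : seq 'I_k, (0 < size w)%N ->
    mu' (\prod_(i <- w) ncX R i) =
    \sum_(m < size w)
      boolean_cumulant nu [seq ncX R i | i <- drop m w ++ take m.+1 w].

Lemma Psi_exist (R : realType) (k : nat) (nu : Dalg R k) :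
  exists mu', is_Psi nu mu'.
Proof. exact: Dalg'_ex. Qed.

Lemma Psi_uniq (R : realType) (k : nat) (nu : Dalg R k) mu' mu'' :
  is_Psi nu mu' -> is_Psi nu mu'' -> mu' = mu''.
Proof. by move=> h h'; apply: Dalg'_eq => w w0; rewrite h ?h'. Qed.

Definition Psi (R : realType) (k : nat) (nu : Dalg R k) : Dalg' R k :=
  sval (cid (Psi_exist nu)).

Lemma PsiP (R : realType) (k : nat) (nu : Dalg R k) : is_Psi nu (Psi nu).
Proof. exact: svalP. Qed.

(* The values of a cumulant family K on the variables of C<X_1, ..., X_(k+l)>
   are those of K1 on words in the first k variables, those of K2 on words in
   the last l variables, and 0 on mixed words. *)
Definition mixed_cumulants_vanish (R : realType) (k l : nat)
    (K1 : seq (ncpoly R k) -> R[i]) (K2 : seq (ncpoly R l) -> R[i])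
    (K : seq (ncpoly R (k + l)) -> R[i]) :=
  [/\ forall w : seq 'I_k, (0 < size w)%N ->
        K [seq ncX R (lshift l i) | i <- w] = K1 [seq ncX R i | i <- w],
      forall w : seq 'I_l, (0 < size w)%N ->
        K [seq ncX R (rshift k i) | i <- w] = K2 [seq ncX R i | i <- w] &
      forall w : seq 'I_(k + l),
        has (fun i : 'I_(k + l) => i < k)%N w ->
        has (fun i : 'I_(k + l) => k <= i)%N w ->
        K [seq ncX R i | i <- w] = 0].

Definition is_free_product (R : realType) (k l : nat)
    (mu1 : Dalg R k) (mu2 : Dalg R l) (mu : Dalg R (k + l)) :=
  mixed_cumulants_vanish (free_cumulant mu1) (free_cumulant mu2)
    (free_cumulant mu).

Section Glue.
Variables (R : realType) (k l : nat).
Variables (K1 : seq (ncpoly R k) -> R[i]) (K2 : seq (ncpoly R l) -> R[i]).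

Definition glue (w : seq 'I_(k + l)) : R[i] :=
  if all (fun i : 'I_(k + l) => i < k)%N w then
    K1 [seq ncX R i | i <- pmap (fun i => if split i is inl j then Some j
                                          else None) w]
  else if has (fun i : 'I_(k + l) => i < k)%N w then 0
  else K2 [seq ncX R i | i <- pmap (fun i => if split i is inr j then Some j
                                             else None) w].

Lemma glueP (K : seq (ncpoly R (k + l)) -> R[i]) :
  mixed_cumulants_vanish K1 K2 K <->
  forall w, (0 < size w)%N -> K [seq ncX R i | i <- w] = glue w.
Proof.
have gl (w : seq 'I_k) : glue (map (@lshift k l) w) = K1 [seq ncX R i | i <- w].
  rewrite /glue all_map /= (eq_all (a2 := predT)) ?all_predT.
    congr (K1 (map _ _)); elim: w => //= i w ->.
    by rewrite -[lshift l i]/(unsplit (inl i)) unsplitK.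
  by move=> i /=; rewrite ltn_ord.
have gr (w : seq 'I_l) : (0 < size w)%N ->
    glue (map (@rshift k l) w) = K2 [seq ncX R i | i <- w].
  move=> w0; have -> : glue (map (@rshift k l) w) = K2 [seq ncX R i | i <-
      pmap (fun i => if split i is inr j then Some j else None)
           (map (@rshift k l) w)].
    rewrite /glue; case: w w0 => //= i w _; rewrite ltnNge leq_addr /=.
    by rewrite has_map (eq_has (a2 := pred0)) ?has_pred0 // => j /=;
      rewrite ltnNge leq_addr.
  congr (K2 (map _ _)); elim: w {w0} => //= i w ->.
  by rewrite -[rshift k i]/(unsplit (inr i)) unsplitK.
have lK (w : seq 'I_(k + l)) : all (fun i : 'I_(k + l) => i < k)%N w ->
    exists w1, w = map (@lshift k l) w1.
  elim: w => [_|i w IHw /= /andP[ik /IHw[w1 ->]]]; first by exists [::].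
  by exists (Ordinal ik :: w1) => /=; congr cons; apply: val_inj.
have rK (w : seq 'I_(k + l)) : all (fun i : 'I_(k + l) => k <= i)%N w ->
    exists w1, w = map (@rshift k l) w1.
  elim: w => [_|i w IHw /= /andP[ik /IHw[w1 ->]]]; first by exists [::].
  have il : (i - k < l)%N by rewrite ltn_subLR.
  by exists (Ordinal il :: w1) => /=; congr cons; apply: val_inj; rewrite /= subnKC.
split=> [[E1 E2 E0] w w0 | E].
  have [/lK[w1 wE]|] := boolP (all (fun i : 'I_(k + l) => i < k)%N w).
    by move: w0; rewrite wE size_map => w0; rewrite gl -map_comp -E1.
  rewrite -has_predC (eq_has (a2 := fun i : 'I_(k + l) => (k <= i)%N)); last first.
    by move=> i; rewrite [LHS]/= -leqNgt.
  move=> hw; have [lw|nl] := boolP (has (fun i : 'I_(k + l) => i < k)%N w).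
    rewrite E0 // /glue lw; case: ifP => // /allP aw.
    by case/hasP: hw => i /aw ik; rewrite leqNgt ik.
  have /rK[w1 wE] : all (fun i : 'I_(k + l) => k <= i)%N w.
    apply/allP => i iw; rewrite [X in is_true X]leqNgt; apply: contra nl => ik.
    by apply/hasP; exists i.
  by move: w0; rewrite wE size_map => w0; rewrite gr // -map_comp -E2.
split=> [w w0|w w0|w lw rw].
- by rewrite (map_comp (@ncX R _)) E ?size_map // gl.
- by rewrite (map_comp (@ncX R _)) E ?size_map // gr.
have w0 : (0 < size w)%N by case: (w) lw.
rewrite E // /glue lw; case: ifP => // /allP aw.
by case/hasP: rw => i /aw ik; rewrite leqNgt ik.
Qed.
End Glue.

Section WordInversion.
Variables (R : realType) (k : nat).
Variable J : forall n, {set {set 'I_n}} -> {set {set 'I_n}}.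
Variable b : forall n, {set {set 'I_n}} -> {set 'I_n} -> {set 'I_n} -> bool.
Hypothesis Jfull : forall n, (0 < n)%N -> @J n [set setT] = [set setT].
Hypothesis bfull : forall n, (0 < n)%N -> @b n [set setT] setT setT.
Local Notation A := (ncpoly R k).
Local Notation mom f := (fun s : seq A => f (\prod_(y <- s) y)).
Local Notation X := (map (@ncX R k)).

Definition word_moment (K kap : seq 'I_k -> R[i]) (w : seq 'I_k) : R[i] :=
  \sum_(P in NC (size w)) cum_term J b (in_tuple w) P K kap.

Lemma cumeq_word_moment K kap : cumeq NC J b (word_moment K kap) K kap.
Proof.
move=> n w _; rewrite /word_moment.
have E m (e : size w = m) (y : m.-tuple 'I_k) : tval y = w ->
    \sum_(P in NC (size w)) cum_term J b (in_tuple w) P K kap =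
    \sum_(P in NC m) cum_term J b y P K kap.
  by subst m => yw; have -> : y = in_tuple w by apply: val_inj.
by rewrite (E _ (size_tuple w) w).
Qed.

Lemma word_cum (f : {scalar A}) (K : seq 'I_k -> R[i]) (kappa kap : seq A -> R[i]) :
  (forall w, (0 < size w)%N ->
     f (\prod_(i <- w) ncX R i) = word_moment K (kap \o X) w) ->
  cumeq NC J b (mom f) kappa kap ->
  forall w, (0 < size w)%N -> kappa (X w) = K w.
Proof.
move=> fw /(cumeq_map (@ncX R k)) E.
apply: (cumeq_uniq _ _ Jfull bfull _ E (g := K) (kap' := kap \o X)) => //.
- exact: NC_part.
- exact: NC_full.
move=> n w n0 /=; rewrite big_map fw ?size_tuple //.
exact: cumeq_word_moment.
Qed.

Lemma word_moment_cum (f : {scalar A}) (K : seq 'I_k -> R[i])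
    (kappa kap : seq A -> R[i]) :
  cumeq NC J b (mom f) kappa kap ->
  (forall w, (0 < size w)%N -> kappa (X w) = K w) ->
  forall w, (0 < size w)%N ->
     f (\prod_(i <- w) ncX R i) = word_moment K (kap \o X) w.
Proof.
move=> /(cumeq_map (@ncX R k)) E kK w w0.
have /= := E _ (in_tuple w) w0; rewrite big_map => ->.
apply: eq_bigr => P PS; apply: cum_term_ext => // V VP.
by rewrite /= kK // size_restr (blockP NC_part PS VP).
Qed.
End WordInversion.

Section Products.
Variables (R : realType) (k l : nat).

Lemma free_product_exist (mu1 : Dalg R k) (mu2 : Dalg R l) :
  exists mu, is_free_product mu1 mu2 mu.
Proof.
pose K := glue (free_cumulant mu1) (free_cumulant mu2).
have [mu muE] := Dalg_ex (word_moment Jone b_all K (fun=> 0)).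
exists mu; apply/glueP.
have /(is_freeE _ _ (fun=> 0))[_ E] := free_cumulantP mu.
exact: (word_cum _ _ muE E).
Qed.

Lemma free_product_uniq (mu1 : Dalg R k) (mu2 : Dalg R l) mu mu' :
  is_free_product mu1 mu2 mu -> is_free_product mu1 mu2 mu' -> mu = mu'.
Proof.
move=> /glueP h /glueP h'; apply: Dalg_eq.
have /(is_freeE _ _ (fun=> 0))[_ E] := free_cumulantP mu.
have /(is_freeE _ _ (fun=> 0))[_ E'] := free_cumulantP mu'.
by move=> w w0; rewrite (word_moment_cum E h) // (word_moment_cum E' h').
Qed.

Definition free_product (mu1 : Dalg R k) (mu2 : Dalg R l) : Dalg R (k + l) :=
  sval (cid (free_product_exist mu1 mu2)).

Lemma free_productP (mu1 : Dalg R k) (mu2 : Dalg R l) :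
  is_free_product mu1 mu2 (free_product mu1 mu2).
Proof. exact: svalP. Qed.

Definition is_cfree_second (mu1 nu1 : Dalg R k) (mu2 nu2 : Dalg R l)
    (nu : Dalg R (k + l)) :=
  mixed_cumulants_vanish (cfree_cumulant mu1 nu1) (cfree_cumulant mu2 nu2)
    (cfree_cumulant (free_product mu1 mu2) nu).

Lemma cfree_second_exist (mu1 nu1 : Dalg R k) (mu2 nu2 : Dalg R l) :
  exists nu, is_cfree_second mu1 nu1 mu2 nu2 nu.
Proof.
pose K := glue (cfree_cumulant mu1 nu1) (cfree_cumulant mu2 nu2).
pose kap := free_cumulant (free_product mu1 mu2).
have [nu nuE] := Dalg_ex (word_moment Jone b_outer K
                            (kap \o map (@ncX R (k + l)))).
exists nu; apply/glueP.
have /is_cfreeE[_ E] := cfree_cumulantP (free_product mu1 mu2) nu.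
by apply: (word_cum _ _ nuE E) => // n _; exact: inner_full.
Qed.

Lemma cfree_second_uniq (mu1 nu1 : Dalg R k) (mu2 nu2 : Dalg R l) nu nu' :
  is_cfree_second mu1 nu1 mu2 nu2 nu -> is_cfree_second mu1 nu1 mu2 nu2 nu' ->
  nu = nu'.
Proof.
move=> /glueP h /glueP h'; apply: Dalg_eq.
have /is_cfreeE[_ E] := cfree_cumulantP (free_product mu1 mu2) nu.
have /is_cfreeE[_ E'] := cfree_cumulantP (free_product mu1 mu2) nu'.
by move=> w w0; rewrite (word_moment_cum E h) // (word_moment_cum E' h').
Qed.

Definition cfree_product (p1 : Dalg R k * Dalg R k) (p2 : Dalg R l * Dalg R l) :
    Dalg R (k + l) * Dalg R (k + l) :=
  (free_product p1.1 p2.1, sval (cid (cfree_second_exist p1.1 p1.2 p2.1 p2.2))).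

Lemma cfree_productP (mu1 nu1 : Dalg R k) (mu2 nu2 : Dalg R l) :
  is_cfree_second mu1 nu1 mu2 nu2 (cfree_product (mu1, nu1) (mu2, nu2)).2.
Proof. exact: svalP. Qed.

Definition is_inf_second (mu1 : Dalg R k) (mu1' : Dalg' R k)
    (mu2 : Dalg R l) (mu2' : Dalg' R l) (mu' : Dalg' R (k + l)) :=
  mixed_cumulants_vanish (inf_cumulant mu1 mu1') (inf_cumulant mu2 mu2')
    (inf_cumulant (free_product mu1 mu2) mu').

Lemma inf_second_exist (mu1 : Dalg R k) (mu1' : Dalg' R k)
    (mu2 : Dalg R l) (mu2' : Dalg' R l) :
  exists mu', is_inf_second mu1 mu1' mu2 mu2' mu'.
Proof.
pose K := glue (inf_cumulant mu1 mu1') (inf_cumulant mu2 mu2').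
pose kap := free_cumulant (free_product mu1 mu2).
have [mu' mu'E] := Dalg'_ex (word_moment Jall b_marked K
                              (kap \o map (@ncX R (k + l)))).
exists mu'; apply/glueP.
have /is_infE[_ E] := inf_cumulantP (free_product mu1 mu2) mu'.
by apply: (word_cum _ _ mu'E E) => // n _; exact: eqxx.
Qed.

Lemma inf_second_uniq (mu1 : Dalg R k) (mu1' : Dalg' R k)
    (mu2 : Dalg R l) (mu2' : Dalg' R l) mu' mu'' :
  is_inf_second mu1 mu1' mu2 mu2' mu' -> is_inf_second mu1 mu1' mu2 mu2' mu'' ->
  mu' = mu''.
Proof.
move=> /glueP h /glueP h'; apply: Dalg'_eq.
have /is_infE[_ E] := inf_cumulantP (free_product mu1 mu2) mu'.
have /is_infE[_ E'] := inf_cumulantP (free_product mu1 mu2) mu''.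
by move=> w w0; rewrite (word_moment_cum E h) // (word_moment_cum E' h').
Qed.

Definition inf_free_product (p1 : Dalg R k * Dalg' R k)
    (p2 : Dalg R l * Dalg' R l) : Dalg R (k + l) * Dalg' R (k + l) :=
  (free_product p1.1 p2.1, sval (cid (inf_second_exist p1.1 p1.2 p2.1 p2.2))).

Lemma inf_free_productP (mu1 : Dalg R k) (mu1' : Dalg' R k)
    (mu2 : Dalg R l) (mu2' : Dalg' R l) :
  is_inf_second mu1 mu1' mu2 mu2' (inf_free_product (mu1, mu1') (mu2, mu2')).2.
Proof. exact: svalP. Qed.
End Products.

(* Main.v *)
Require Import Defs.
From mathcomp Require Import all_boot all_order all_algebra.
From mathcomp Require Import reals complex monalg ring.
Set Implicit Arguments.
Unset Strict Implicit.
Unset Printing Implicit Defensive.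
Import GRing.Theory.
Local Open Scope ring_scope.

(* Write kappa, kappa^c, beta for the free, c-free and Boolean cumulants of
   (mu, nu). Grouping non-crossing partitions by the block of the first letter
   shows that beta(x_1, ..., x_n) is the sum over the non-crossing partitions
   with 1 and n in one block V of kappa^c(x | V) times the kappa's of the other
   blocks. In Psi(nu) the first and last letters of the word fed to beta are the
   same letter x_m; gluing these two positions turns the sum into one over the
   non-crossing partitions of a rotation of (x_1, ..., x_n), with a distinguished
   element m in a distinguished block V. If kappa is invariant under rotation
   (mu tracial) everything can be rotated back, and the result is the
   moment-cumulant formula for
     kappa'(x_1, ..., x_n) =
       sum_m kappa^c(x_m, ..., x_n, x_1, ..., x_m).
   This formula, valid for both factors and for the free product, preserves the
   vanishing of mixed cumulants. *)

(** * Increasing enumerations of sets of positions *)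

Definition ord_lt n (i j : 'I_n) := (i < j)%N.

Lemma ord_lt_trans n : transitive (@ord_lt n).
Proof. by move=> j i k; apply: ltn_trans. Qed.

Lemma ord_lt_irr n : irreflexive (@ord_lt n).
Proof. by move=> i; apply: ltnn. Qed.

Lemma sorted_enum n (V : {set 'I_n}) : sorted (@ord_lt n) (enum V).
Proof.
rewrite {1}/enum_mem; apply: (sorted_filter (@ord_lt_trans n)).
by have := iota_ltn_sorted 0 n; rewrite -val_enum_ord sorted_map -enumT.
Qed.

Lemma enum_sortedE n (V : {set 'I_n}) s :
  sorted (@ord_lt n) s -> s =i V -> enum V = s.
Proof.
move=> ss sV; apply: (irr_sorted_eq (@ord_lt_trans n) (@ord_lt_irr n)) => //.
  exact: sorted_enum.
by move=> i; rewrite mem_enum sV.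
Qed.

Lemma cat_sorted n (s t : seq 'I_n) : sorted (@ord_lt n) s ->
  sorted (@ord_lt n) t -> {in s & t, forall i j : 'I_n, (i < j)%N} ->
  sorted (@ord_lt n) (s ++ t).
Proof.
rewrite !(sorted_pairwise (@ord_lt_trans n)) pairwise_cat => -> -> st.
by rewrite !andbT; apply/allrelP => i j si tj; apply: st.
Qed.

Lemma enum_setU_lt n (V W : {set 'I_n}) :
  {in V & W, forall i j : 'I_n, (i < j)%N} -> enum (V :|: W) = enum V ++ enum W.
Proof.
move=> VW; apply: enum_sortedE; last by move=> i; rewrite mem_cat !mem_enum inE.
apply: cat_sorted; rewrite ?sorted_enum // => i j; rewrite !mem_enum; exact: VW.
Qed.

Lemma enum_imset_homo m n (h : 'I_m -> 'I_n) (V : {set 'I_m}) :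
  {in V &, {homo h : i j / (i < j)%N}} -> enum (h @: V) = map h (enum V).
Proof.
move=> hlt; apply: enum_sortedE.
  apply: (homo_sorted_in (P := [in V])); [exact: hlt | by apply/allP => i; rewrite mem_enum |].
  exact: sorted_enum.
move=> i; apply/mapP/imsetP => -[j jV ->]; exists j => //.
  by rewrite mem_enum in jV.
by rewrite mem_enum.
Qed.

(** * Blocks of non-crossing partitions *)

Section Blocks.
Variable n : nat.
Implicit Types (V W A B C : {set 'I_n}) (P : {set {set 'I_n}}).

Lemma block_minP V : V != set0 ->
  exists2 v, v \in V & block_min V = v /\ {in V, forall u : 'I_n, (v <= u)%N}.
Proof.
case/set0Pn => v0 v0V; case: (arg_minnP (@nat_of_ord n) v0V) => v vV vmin.
exists v => //; split=> //; apply/eqP; rewrite eqn_leq; apply/andP; split.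
  rewrite /block_min; have := mem_index_enum v.
  elim: (index_enum _) => // i s IHs; rewrite inE big_cons => /predU1P[<-|/IHs le_s].
    by have -> : v \in V by []; apply: geq_minl.
  by case: ifP => // _; apply: leq_trans (geq_minr _ _) le_s.
apply: (big_ind (fun m => v <= m)%N) => //; first exact: ltnW.
by move=> a b va vb; rewrite leq_min va.
Qed.

Lemma block_maxP V : V != set0 ->
  exists2 v, v \in V & block_max V = v /\ {in V, forall u : 'I_n, (u <= v)%N}.
Proof.
case/set0Pn => v0 v0V; case: (arg_maxnP (@nat_of_ord n) v0V) => v vV vmax.
exists v => //; split=> //; apply/eqP; rewrite eqn_leq; apply/andP; split.
  by apply/bigmax_leqP => i; apply: vmax.
exact: leq_bigmax_cond.
Qed.

(* [V] lies strictly inside the convex hull of [W]. *)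
Definition nested V W :=
  [exists a in W, exists b in W, [forall v in V, (a < v < b)%N]].

Lemma nestedP V W : reflect (exists a b, [/\ a \in W, b \in W &
  {in V, forall v : 'I_n, (a < v < b)%N}]) (nested V W).
Proof.
apply: (iffP exists_inP) => [[a aW /exists_inP[b bW /forall_inP h]]|[a [b [aW bW h]]]].
  by exists a, b.
by exists a => //; apply/exists_inP; exists b => //; apply/forall_inP.
Qed.

Definition covered P V := [exists W in P, nested V W].

Lemma block_neq0 P A V : partition P A -> V \in P -> V != set0.
Proof. by case/and3P => _ _ P0 VP; apply: contraNneq P0 => <-. Qed.

(** The hull of a nonempty block is spanned by its least and greatest elements, which serve as the
    witnesses of [nested]. The form [covered] is easier to transport along increasing maps. *)
Lemma innerE P A V : partition P A -> V \in P -> inner P V = covered P V.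
Proof.
move=> PA VP; apply: eq_existsb_in => W WP.
have [v vV [-> vmin]] := block_minP (block_neq0 PA VP).
have [v' v'V [-> vmax]] := block_maxP (block_neq0 PA VP).
have [w wW [-> wmin]] := block_minP (block_neq0 PA WP).
have [w' w'W [-> wmax]] := block_maxP (block_neq0 PA WP).
apply/and3P/nestedP => [[h1 h2 h3]|[a [b [aW bW h]]]].
  exists w, w'; split=> // u uV.
  by rewrite (leq_trans h1) ?vmin //= (leq_ltn_trans _ h3) ?vmax.
have /andP[av _] := h v vV; have /andP[_ vb] := h v' v'V.
by rewrite (leq_ltn_trans _ av) ?wmin // vmin // (leq_trans vb) ?wmax.
Qed.

Lemma noncrossingP P : reflect
  (forall V W a b c d, V \in P -> W \in P -> V != W -> a \in V -> b \in W ->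
     c \in V -> d \in W -> (a < b)%N -> (b < c)%N -> (c < d)%N -> False)
  (noncrossing P).
Proof.
apply: (iffP forall_inP) => [h V W a b c d VP WP VW aV bW cV dW ab bc cd|h V VP].
  have /forall_inP/(_ W WP)/implyP/(_ VW)/negP := h V VP; apply.
  apply/exists_inP; exists a => //; apply/exists_inP; exists b => //.
  apply/exists_inP; exists c => //; apply/exists_inP; exists d => //.
  exact/and3P.
apply/forall_inP => W WP; apply/implyP => VW; apply/negP.
case/exists_inP => a aV /exists_inP[b bW /exists_inP[c cV /exists_inP[d dW]]].
by case/and3P; apply: (h V W).
Qed.

(** At [setT] this is [NC n]; other subsets occur because the recursion on the first block restricts
    partitions to gaps. *)
Definition NCin A : {set {set {set 'I_n}}} :=
  [set P | partition P A && noncrossing P].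

Lemma NCinP A P : reflect (partition P A /\ noncrossing P) (P \in NCin A).
Proof. by rewrite inE; apply: andP. Qed.

Lemma block_sub P A V : partition P A -> V \in P -> V \subset A.
Proof. by case/and3P => /eqP <- _ _ VP; apply: bigcup_sup. Qed.

(** The last hypothesis puts [B] into a single gap of [C]. A crossing of a block in [B] with a block
    in [C] would place an element of [C] between two of [B]. *)
Lemma NCin_setU P (Q : {set {set 'I_n}}) B C :
  P \in NCin B -> Q \in NCin C -> [disjoint B & C] ->
  (forall b b' c, b \in B -> b' \in B -> c \in C -> (b < c < b')%N -> False) ->
  P :|: Q \in NCin (B :|: C).
Proof.
move=> /NCinP[PB ncP] /NCinP[QC ncQ] dBC conv; apply/NCinP; split.
  have [/eqP cP tP P0] := and3P PB; have [/eqP cQ tQ Q0] := and3P QC.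
  apply/and3P; split; last by rewrite inE negb_or P0.
    by rewrite /cover bigcup_setU -/(cover P) -/(cover Q) cP cQ.
  by apply: trivIsetU => //; rewrite cP cQ.
apply/noncrossingP => V W a b c d; rewrite !inE.
case/orP=> VP /orP[] WP VW aV bW cV dW ab bc cd.
- exact: (noncrossingP _ ncP V W a b c d).
- apply: (conv a c b); rewrite ?ab ?bc //; first exact: (subsetP (block_sub PB VP)).
    exact: (subsetP (block_sub PB VP)).
  exact: (subsetP (block_sub QC WP)).
- apply: (conv b d c); rewrite ?bc ?cd //; first exact: (subsetP (block_sub PB WP)).
    exact: (subsetP (block_sub PB WP)).
  exact: (subsetP (block_sub QC VP)).
- exact: (noncrossingP _ ncQ V W a b c d).
Qed.

Lemma setI_powersetE P B C : partition P (B :|: C) -> [disjoint B & C] ->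
  (forall V, V \in P -> (V \subset B) || (V \subset C)) ->
  partition (P :&: powerset B) B.
Proof.
move=> PA dBC ref; have [/eqP cP tP P0] := and3P PA.
apply/and3P; split; last by rewrite inE (negPf P0).
  apply/eqP/setP => i; apply/bigcupP/idP => [[V]|iB].
    by rewrite !inE => /andP[_ /subsetP VB] /VB.
  have : i \in cover P by rewrite cP inE iB.
  case/bigcupP => V VP iV; exists V => //; rewrite !inE VP /=.
  case/orP: (ref V VP) => // /subsetP/(_ i iV) iC.
  by have := disjointFr dBC iB; rewrite iC.
by apply: trivIsetS tP; apply: subsetIl.
Qed.

Lemma noncrossingS P (Q : {set {set 'I_n}}) :
  Q \subset P -> noncrossing P -> noncrossing Q.
Proof.
move=> /subsetP QP /noncrossingP h; apply/noncrossingP => V W a b c d VQ WQ.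
by apply: h; apply: QP.
Qed.

(** Taking unions is inverted by sorting the blocks into those inside [B] and those inside [C]; the
    hypothesis on [Q] ensures that every block falls on one side. *)
Lemma sum_NCin_split (K : nmodType) B C (Q : pred {set {set 'I_n}})
    (F : {set {set 'I_n}} -> K) : [disjoint B & C] ->
  (forall b b' c, b \in B -> b' \in B -> c \in C -> (b < c < b')%N -> False) ->
  (forall P, P \in NCin (B :|: C) -> Q P ->
     forall V, V \in P -> (V \subset B) || (V \subset C)) ->
  \sum_(P in NCin (B :|: C) | Q P) F P =
  \sum_(P in NCin B) \sum_(P' in NCin C | Q (P :|: P')) F (P :|: P').
Proof.
move=> dBC conv ref; rewrite pair_big_dep /=.
rewrite (reindex_onto (fun p => p.1 :|: p.2)
  (fun P => (P :&: powerset B, P :&: powerset C))) /=; last first.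
  move=> P /andP[PA QP]; rewrite -setIUr; apply/setIidPl/subsetP => V VP.
  by rewrite !inE; apply: ref PA QP V VP.
apply: eq_bigl => -[P1 P2] /=; apply/idP/idP; last first.
  case/and3P=> P1B P2C QP; rewrite NCin_setU // QP /=.
  have [[p1 _] [p2 _]] := (NCinP _ _ P1B, NCinP _ _ P2C).
  rewrite xpair_eqE; apply/andP; split; apply/eqP/setP => V; rewrite !inE.
    apply/andP/idP => [[/orP[//|VP2] VB]|VP1]; last first.
      by rewrite VP1 (block_sub p1 VP1).
    have /set0Pn[i iV] := block_neq0 p2 VP2.
    by have := disjointFr dBC (subsetP VB i iV); rewrite (subsetP (block_sub p2 VP2)).
  apply/andP/idP => [[/orP[VP1|//] VC]|VP2]; last first.
    by rewrite VP2 orbT (block_sub p2 VP2).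
  have /set0Pn[i iV] := block_neq0 p1 VP1.
  by have := disjointFl dBC (subsetP VC i iV); rewrite (subsetP (block_sub p1 VP1)).
case/andP => /andP[PA QP] /eqP[E1 E2]; rewrite QP andbT.
have r := ref _ PA QP; have [pA nc] := NCinP _ _ PA.
apply/andP; split; [rewrite -E1 | rewrite -E2]; apply/NCinP; split.
- exact: (setI_powersetE pA).
- by apply: noncrossingS nc; apply: subsetIl.
- apply: (@setI_powersetE _ C B); rewrite ?(setUC C B) //.
    by rewrite disjoint_sym.
  by move=> V /r; rewrite orbC.
- by apply: noncrossingS nc; apply: subsetIl.
Qed.
End Blocks.

(** * Transport of partitions along injections *)

Definition imblocks m n (h : 'I_m -> 'I_n) (P : {set {set 'I_m}}) :
  {set {set 'I_n}} := [set h @: (V : {set 'I_m}) | V in P].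

Lemma imblocks_inj m n (h : 'I_m -> 'I_n) : injective h -> injective (imblocks h).
Proof. by move=> h_inj; apply/imset_inj/imset_inj. Qed.

Lemma partition_imblocks m n (h : 'I_m -> 'I_n) P (A : {set 'I_m}) : injective h ->
  partition (imblocks h P) (h @: A) = partition P A.
Proof. by move=> h_inj; apply: imset_partition. Qed.

Lemma big_imblocks (K : comNzRingType) m n (h : 'I_m -> 'I_n)
    (F : {set 'I_n} -> K) P : injective h ->
  \prod_(V in imblocks h P) F V = \prod_(V in P) F (h @: V).
Proof. by move=> h_inj; rewrite big_imset //; apply: in2W; apply: imset_inj. Qed.

Section Increasing.
Variables (m n : nat) (h : 'I_m -> 'I_n).
Hypothesis h_homo : {homo h : i j / (i < j)%N}.

Lemma homo_ord_mono : {mono h : i j / (i < j)%N}.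
Proof.
move=> i j; case: (ltngtP i j) => [/h_homo-> //|/h_homo ji|/val_inj->].
  by apply/negbTE; rewrite -leqNgt ltnW.
by rewrite ltnn.
Qed.

Lemma homo_ord_inj : injective h.
Proof.
move=> i j hij; case: (ltngtP i j) => [/h_homo|/h_homo|/val_inj //];
  by rewrite hij ltnn.
Qed.

Lemma covered_imblocks P (V : {set 'I_m}) :
  covered (imblocks h P) (h @: V) = covered P V.
Proof.
apply/exists_inP/exists_inP => [[_ /imsetP[W WP ->]]|[W WP]].
  case/nestedP => _ [_ [/imsetP[a aW ->] /imsetP[b bW ->] VW]].
  exists W => //; apply/nestedP; exists a, b; split=> // v vV.
  by have := VW _ (imset_f h vV); rewrite !homo_ord_mono.
case/nestedP => a [b [aW bW VW]]; exists (h @: W); first exact: imset_f.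
apply/nestedP; exists (h a), (h b); split; try exact: imset_f.
by move=> _ /imsetP[v vV ->]; rewrite !homo_ord_mono; apply: VW.
Qed.

Lemma noncrossing_imblocks P : noncrossing (imblocks h P) = noncrossing P.
Proof.
apply/noncrossingP/noncrossingP => nc V W a b c d.
  move=> VP WP VW aV bW cV dW ab bc cd.
  apply: (nc (h @: V) (h @: W) (h a) (h b) (h c) (h d));
    rewrite ?homo_ord_mono ?imset_f //.
  by apply: contra_neq VW; apply: imset_inj homo_ord_inj _ _.
move=> /imsetP[{}V VP ->] /imsetP[{}W WP ->] VW.
move=> /imsetP[{}a aV ->] /imsetP[{}b bW ->] /imsetP[{}c cV ->] /imsetP[{}d dW ->].
rewrite !homo_ord_mono; apply: (nc V W) => //.
by apply: contra_neq VW => ->.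
Qed.

Lemma NCin_imset (A : {set 'I_m}) : NCin (h @: A) = imblocks h @: NCin A.
Proof.
apply/setP => Q; apply/NCinP/imsetP => [[QA nc]|[P /NCinP[PA nc] ->]]; last first.
  by rewrite partition_imblocks ?noncrossing_imblocks //; apply: homo_ord_inj.
(* Every block of [Q] lies in the image of [h], so it is the image of its preimage. *)
pose P := [set h @^-1: (V : {set 'I_n}) | V in Q].
have QE : Q = imblocks h P.
  rewrite /imblocks /P -imset_comp -[LHS]imset_id; apply: eq_in_imset => V VQ /=.
  apply/setP => i; apply/idP/imsetP => [iV|[j]]; last by rewrite inE => ? ->.
  have /imsetP[j jA ij] := subsetP (block_sub QA VQ) i iV.
  by exists j; rewrite // inE -ij.
exists P => //; apply/NCinP.
by rewrite -noncrossing_imblocks -(partition_imblocks _ _ homo_ord_inj) -QE.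
Qed.
End Increasing.

(** * Sums over non-crossing partitions and their first block *)

Section NCSum.
Variables (K : comNzRingType) (T : Type).
Implicit Types (fi fo f M N : seq T -> K).

Definition block_weight n (x : n.-tuple T) fi fo (P : {set {set 'I_n}}) : K :=
  \prod_(V in P) (if covered P V then fi (restr x V) else fo (restr x V)).

Definition nc_sum n (x : n.-tuple T) fi fo (A : {set 'I_n}) : K :=
  \sum_(P in NCin A) block_weight x fi fo P.

(** The right-hand side of the c-free moment formula, with weight [fi] on inner and [fo] on outer
    blocks; [fi = fo] gives the free one. *)
Definition nc_moment fi fo (w : seq T) : K :=
  nc_sum (in_tuple w) fi fo setT.

Lemma nc_momentE n (x : n.-tuple T) fi fo :
  nc_moment fi fo x = nc_sum x fi fo setT.
Proof.
have E m (e : size x = m) (y : m.-tuple T) : tval y = x ->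
    nc_moment fi fo x = nc_sum y fi fo setT.
  by subst m => yx; have -> : y = in_tuple x by apply: val_inj.
exact: (E _ (size_tuple x) x).
Qed.

Lemma nc_sum_imset m n (h : 'I_m -> 'I_n) (x : n.-tuple T) (y : m.-tuple T)
    fi fo (A : {set 'I_m}) : {homo h : i j / (i < j)%N} ->
  (forall i, tnth y i = tnth x (h i)) ->
  nc_sum x fi fo (h @: A) = nc_sum y fi fo A.
Proof.
move=> hh yx; have h_inj := homo_ord_inj hh.
have restrE (V : {set 'I_m}) : restr x (h @: V) = restr y V.
  rewrite /restr enum_imset_homo; last by move=> i j _ _; apply: hh.
  by rewrite -map_comp; apply: eq_map => i; rewrite yx.
rewrite /nc_sum (NCin_imset hh) big_imset /=; last first.
  by move=> P P' _ _; apply: imblocks_inj.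
apply: eq_bigr => P _; rewrite /block_weight big_imblocks //.
by apply: eq_bigr => V _; rewrite (covered_imblocks hh) restrE.
Qed.

(** Crossing and covering depend only on the order of positions, so [A] can be relabelled by the
    increasing bijection [enum_val]. *)
Lemma nc_sum_restr n (x : n.-tuple T) fi fo (A : {set 'I_n}) :
  nc_sum x fi fo A = nc_moment fi fo (restr x A).
Proof.
have sA : size (restr x A) == #|A| by rewrite size_restr.
pose h (i : 'I_#|A|) : 'I_n := enum_val i.
have hh : {homo h : i j / (i < j)%N}.
  move=> i j ij; rewrite /h !(enum_val_nth (h i)).
  have/(sorted_ltn_nth (@ord_lt_trans n)) := sorted_enum A; apply => //;
    by rewrite inE -cardE.
have hA : h @: [set: 'I_#|A|] = A.
  apply/setP => i; apply/imsetP/idP => [[j _ ->]|iA]; first exact: enum_valP.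
  by exists (enum_rank_in iA i); rewrite // /h enum_rankK_in.
have yx i : tnth (Tuple sA) i = tnth x (h i).
  by rewrite (tnth_nth (tnth x (h i))) /= (nth_map (h i)) -?cardE // -enum_val_nth.
rewrite -{1}hA (nc_sum_imset _ _ _ hh yx).
by rewrite -nc_momentE.
Qed.

(* The sum over all ways to write [acc ++ w] as g_0 v_1 g_1 ... v_r g_r, with
   [acc] a prefix of g_0, of f (v_1, ..., v_r) M(g_0) ... M(g_(r-1)) N(g_r). *)
Fixpoint gap_sum M N f acc w : K :=
  if w is c :: w' then
    M acc * gap_sum M N (fun v => f (c :: v)) [::] w' +
      gap_sum M N f (rcons acc c) w'
  else f [::] * N acc.

Lemma eq_gap_sum M M' N N' f f' acc w : M =1 M' -> N =1 N' -> f =1 f' ->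
  gap_sum M N f acc w = gap_sum M' N' f' acc w.
Proof.
move=> EM EN; elim: w f f' acc => [|c w IHw] f f' acc Ef /=.
  by rewrite Ef EN.
rewrite EM; congr (_ * _ + _); last exact: IHw.
by apply: IHw => v; apply: Ef.
Qed.

(** The weights may differ on the two sides because a block that is outer in [P] can be covered by a
    block of [Q], and conversely. *)
Lemma block_weightU n (x : n.-tuple T) fi fo gi go ki ko
    (P Q : {set {set 'I_n}}) : [disjoint P & Q] ->
  (forall V, V \in P ->
     (if covered (P :|: Q) V then fi (restr x V) else fo (restr x V))
     = (if covered P V then gi (restr x V) else go (restr x V))) ->
  (forall V, V \in Q ->
     (if covered (P :|: Q) V then fi (restr x V) else fo (restr x V))
     = (if covered Q V then ki (restr x V) else ko (restr x V))) ->
  block_weight x fi fo (P :|: Q) =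
  block_weight x gi go P * block_weight x ki ko Q.
Proof.
move=> dPQ EP EQ; rewrite /block_weight.
rewrite (eq_bigl [in [predU P & Q]]); last by move=> V; rewrite !inE.
by rewrite bigU //; congr (_ * _); apply: eq_bigr.
Qed.

Lemma disjoint_NCin n (B C : {set 'I_n}) (P Q : {set {set 'I_n}}) :
  P \in NCin B -> Q \in NCin C -> [disjoint B & C] -> [disjoint P & Q].
Proof.
move=> /NCinP[PB _] /NCinP[QC _] dBC; apply/pred0P => V /=; apply/negP.
case/andP => VP VQ; have /set0Pn[i iV] := block_neq0 PB VP.
have := disjointFr dBC (subsetP (block_sub PB VP) i iV).
by rewrite (subsetP (block_sub QC VQ)).
Qed.

Lemma pblock_setUr n (B C : {set 'I_n}) (P Q : {set {set 'I_n}}) i :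
  P :|: Q \in NCin (B :|: C) -> Q \in NCin C -> i \in C -> pblock (P :|: Q) i = pblock Q i.
Proof.
move=> /NCinP[/and3P[_ tPQ _] _] /NCinP[/and3P[/eqP cQ _ _] _] iC.
apply: def_pblock => //; last by rewrite mem_pblock cQ.
by rewrite inE pblock_mem ?orbT // cQ.
Qed.

Section State.
Variables (n : nat) (x : n.-tuple T) (fi fo : seq T -> K) (i0 : 'I_n).

(* The letters of [S] have been put in the block of the pivot [i0], and those of
   [B], the current gap, out of it. *)
Definition pivot_state (S B : {set 'I_n}) (P : {set {set 'I_n}}) :=
  (S \subset pblock P i0) && [disjoint pblock P i0 & B].

Lemma pivot_last (S B : {set 'I_n}) : i0 \in S ->
    {in S & B, forall i j : 'I_n, (i < j)%N} ->
  \sum_(P in NCin (B :|: S) | pivot_state S B P) block_weight x fi fo P =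
  fo (restr x S) * nc_moment fi fo (restr x B).
Proof.
move=> i0S SB; have dBS : [disjoint B & S].
  by apply/pred0P => i /=; apply/negP => /andP[iB /SB/(_ iB)]; rewrite ltnn.
have S1 : [set S] \in NCin S.
  apply/NCinP; split; last first.
    by apply/noncrossingP => V W a b c d; rewrite !inE => /eqP-> /eqP->; rewrite eqxx.
  apply/and3P; split; first by rewrite /cover big_set1.
    by apply/trivIsetP => V W; rewrite !inE => /eqP-> /eqP->; rewrite eqxx.
  by rewrite inE; apply/eqP => S0; rewrite -S0 inE in i0S.
have conv b b' c : b \in B -> b' \in B -> c \in S -> (b < c < b')%N -> False.
  by move=> bB _ cS /andP[bc _]; have := SB c b cS bB; rewrite ltnNge ltnW.
rewrite sum_NCin_split //; last first.
  move=> P /NCinP[PA _] /andP[SV dVB] W WP; have [/eqP cP tP _] := and3P PA.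
  have i0P : i0 \in cover P by rewrite cP inE i0S orbT.
  have [WV|WV] := eqVneq W (pblock P i0).
    apply/orP; right; apply/subsetP => i iW.
    have := subsetP (block_sub PA WP) i iW; rewrite inE => /orP[iB|//].
    by have := disjointFl dVB iB; rewrite -WV iW.
  apply/orP; left; apply/subsetP => i iW.
  have := subsetP (block_sub PA WP) i iW; rewrite inE => /orP[//|iS].
  case/eqP: WV; rewrite -(def_pblock tP WP iW); apply: def_pblock => //.
    exact: pblock_mem.
  exact: (subsetP SV).
rewrite -nc_sum_restr mulrC /nc_sum mulr_suml; apply: eq_bigr => P1 P1B.
rewrite (big_pred1 [set S]) => [|P2] /=.
  have [P1p _] := NCinP _ _ P1B.
  rewrite (@block_weightU _ _ _ _ fi fo fi fo) ?(disjoint_NCin P1B S1) //.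
  - rewrite {2}/block_weight big_set1 -if_neg; case: ifPn => // /negbNE.
    by case/exists_inP => W /set1P-> /nestedP[a [b [aS bS /(_ a aS)]]]; rewrite ltnn.
  - move=> V VP1; congr (if _ then _ else _).
    apply/exists_inP/exists_inP => -[W WP VW]; last by exists W; rewrite // inE WP.
    move: WP VW; rewrite !inE => /orP[WP1|/eqP->] VW; first by exists W.
    have /set0Pn[v vV] := block_neq0 P1p VP1.
    case/nestedP: VW => a [b [aS bS /(_ v vV) /andP[_ vb]]].
    have := SB b v bS (subsetP (block_sub P1p VP1) v vV).
    by rewrite ltnNge ltnW.
  move=> V /set1P->; congr (if _ then _ else _).
  apply/exists_inP/exists_inP => -[W WP SW]; last by exists W; rewrite // inE WP orbT.
  move: WP SW; rewrite inE => /orP[WP1|WS] SW; last by exists W.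
  case/nestedP: SW => a [b [aW _ /(_ i0 i0S) /andP[ai0 _]]].
  have := SB i0 a i0S (subsetP (block_sub P1p WP1) a aW).
  by rewrite ltnNge ltnW.
apply/andP/eqP => [[P2S st]|->]; last first.
  split=> //; rewrite /pivot_state (pblock_setUr (NCin_setU P1B S1 dBS conv) S1 i0S).
  have -> : pblock [set S] i0 = S.
    by apply: def_pblock; rewrite ?set11 //; have [/and3P[]] := NCinP _ _ S1.
  by rewrite subxx disjoint_sym.
move: st; rewrite /pivot_state (pblock_setUr (NCin_setU P1B P2S dBS conv) P2S i0S).
case/andP=> SV _.
(* A partition of [S] with a block containing [S] is [[set S]]. *)
have [P2p _] := NCinP _ _ P2S; have [/eqP cP2 tP2 _] := and3P P2p.
have VP2 : pblock P2 i0 \in P2 by rewrite pblock_mem // cP2.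
have VE : pblock P2 i0 = S.
  by apply/eqP; rewrite eqEsubset SV (block_sub P2p VP2).
rewrite VE in VP2; apply/setP => W; rewrite inE; apply/idP/eqP => [WP2|->//].
have /set0Pn[i iW] := block_neq0 P2p WP2.
by rewrite -(def_pblock tP2 WP2 iW) (def_pblock tP2 VP2) // (subsetP (block_sub P2p WP2)).
Qed.
(** Putting [j] into the pivot block closes the gap [B]: the pivot block now covers every block in
    [B], whence the weight [fi] throughout, and a new empty gap begins. *)
Lemma pivot_step (S B C : {set 'I_n}) (j : 'I_n) : i0 \in S ->
    {in S & B, forall i k : 'I_n, (i < k)%N} -> {in S, forall i : 'I_n, (i < j)%N} ->
    {in B, forall i : 'I_n, (i < j)%N} -> {in C, forall i : 'I_n, (j < i)%N} ->
  \sum_(P in NCin (B :|: (S :|: (j |: C))) |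
      pivot_state S B P && (j \in pblock P i0)) block_weight x fi fo P =
  nc_moment fi fi (restr x B) *
  \sum_(P in NCin (set0 :|: (S :|: [set j] :|: C)) |
      pivot_state (S :|: [set j]) set0 P) block_weight x fi fo P.
Proof.
move=> i0S SB Sj Bj jC; set A := S :|: (j |: C).
have i0A : i0 \in A by rewrite !inE i0S.
have conv b b' c : b \in B -> b' \in B -> c \in A -> (b < c < b')%N -> False.
  move=> bB b'B cA /andP[bc cb']; move: cA; rewrite !inE => /or3P[cS|/eqP cj|/jC jc].
  - by have := SB c b cS bB; rewrite ltnNge ltnW.
  - by have := Bj b' b'B; rewrite -cj ltnNge ltnW.
  by have := ltn_trans (ltn_trans (Bj b' b'B) jc) cb'; rewrite ltnn.
have dBA : [disjoint B & A].
  apply/pred0P => i /=; apply/negP; rewrite !inE => /andP[iB /or3P[iS|/eqP ij|/jC]].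
  - by have := SB i i iS iB; rewrite ltnn.
  - by have := Bj i iB; rewrite ij ltnn.
  by rewrite ltnNge ltnW ?Bj.
rewrite sum_NCin_split //; last first.
  move=> P /NCinP[PA nc] /andP[/andP[SV dVB] jV] W WP.
  have [/eqP cP tP _] := and3P PA.
  have VP : pblock P i0 \in P by rewrite pblock_mem // cP inE i0A orbT.
  have [WB|/subsetPn[c cW cB]] := boolP (W \subset B); first by [].
  have cA : c \in A.
    by have := subsetP (block_sub PA WP) c cW; rewrite inE (negPf cB).
  apply/subsetP => b bW; have := subsetP (block_sub PA WP) b bW.
  rewrite inE => /orP[bB|//].
  have WV : pblock P i0 != W.
    by apply: contraTneq dVB => ->; apply/pred0Pn; exists b; rewrite /= bW.
  have cV : c \notin pblock P i0.
    by apply: contra WV => cV; rewrite -(def_pblock tP WP cW) (def_pblock tP VP cV).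
  have jc : (j < c)%N.
    move: cA; rewrite !inE => /or3P[/(subsetP SV)|/eqP cj|/jC //].
      by rewrite (negPf cV).
    by rewrite cj jV in cV.
  (* A block joining [b] in the gap to [c] beyond [j] would cross the pivot block. *)
  case: (noncrossingP _ nc _ _ i0 b j c VP WP WV) => //.
  - by apply: (subsetP SV).
  - exact: SB.
  exact: Bj.
rewrite set0U -[S :|: _ :|: C]setUA -/A -nc_sum_restr /nc_sum mulr_suml.
apply: eq_bigr => P1 P1B; rewrite mulr_sumr; have [P1p _] := NCinP _ _ P1B.
have st P2 : P2 \in NCin A -> (pivot_state S B (P1 :|: P2) &&
    (j \in pblock (P1 :|: P2) i0)) = pivot_state (S :|: [set j]) set0 P2.
  move=> P2A; have [P2p _] := NCinP _ _ P2A; have [/eqP cP2 tP2 _] := and3P P2p.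
  rewrite /pivot_state (pblock_setUr (NCin_setU P1B P2A dBA conv) P2A i0A).
  rewrite subUset sub1set -[[disjoint _ & set0]]setI_eq0 setI0 eqxx andbT.
  have V2 : pblock P2 i0 \subset A by rewrite (block_sub P2p) // pblock_mem // cP2.
  by rewrite (disjointWl V2) ?andbT // disjoint_sym.
rewrite (eq_bigl (fun P2 => (P2 \in NCin A) && pivot_state (S :|: [set j]) set0 P2)).
  apply: eq_bigr => P2 /andP[P2A]; rewrite -(st P2 P2A).
  have [P2p _] := NCinP _ _ P2A; have [/eqP cP2 tP2 _] := and3P P2p.
  rewrite /pivot_state (pblock_setUr (NCin_setU P1B P2A dBA conv) P2A i0A).
  case/andP=> _ jV; have VP2 : pblock P2 i0 \in P2 by rewrite pblock_mem // cP2.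
  have i0V : i0 \in pblock P2 i0 by rewrite mem_pblock cP2.
  rewrite (@block_weightU _ _ _ _ fi fi fi fo) ?(disjoint_NCin P1B P2A) //.
    move=> V VP1; rewrite if_same; case: ifPn => // /negP[].
    apply/exists_inP; exists (pblock P2 i0); first by rewrite inE VP2 orbT.
    apply/nestedP; exists i0, j; split=> // v vV.
    by have vB := subsetP (block_sub P1p VP1) v vV; rewrite SB // Bj.
  move=> V V_P2; congr (if _ then _ else _).
  apply/exists_inP/exists_inP => -[W WP VW]; last by exists W; rewrite // inE WP orbT.
  move: WP VW; rewrite inE => /orP[WP1|WP2] VW; last by exists W.
  have /set0Pn[v vV] := block_neq0 P2p V_P2.
  case/nestedP: VW => a [b [aW bW /(_ v vV)]] /conv[].
  - exact: (subsetP (block_sub P1p WP1)).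
  - exact: (subsetP (block_sub P1p WP1)).
  exact: (subsetP (block_sub P2p V_P2)).
by move=> P2; case P2A: (P2 \in NCin A); rewrite //= st.
Qed.

(** Induction on the unread letters [c]: the next one joins either the pivot block or the current
    gap, and these cases are the two summands of [gap_sum]. *)
Lemma sum_pivot_state (c : seq 'I_n) (S B : {set 'I_n}) : i0 \in S ->
    {in S & B, forall i j : 'I_n, (i < j)%N} ->
    {in S & c, forall i j : 'I_n, (i < j)%N} ->
    {in B & c, forall i j : 'I_n, (i < j)%N} -> sorted (@ord_lt n) c ->
  \sum_(P in NCin (B :|: (S :|: [set i in c])) | pivot_state S B P)
     block_weight x fi fo P =
  gap_sum (nc_moment fi fi) (nc_moment fi fo) (fun v => fo (restr x S ++ v))
    (restr x B) (map (tnth x) c).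
Proof.
elim: c S B => [|j c IHc] S B i0S SB Sc Bc /=.
  have -> : [set i in [::]] = set0 :> {set 'I_n} by apply/setP => i; rewrite !inE.
  by rewrite setU0 cats0 pivot_last.
rewrite (path_sortedE (@ord_lt_trans n)) => /andP[/allP jc c_s].
have -> : [set i in j :: c] = j |: [set i in c] by apply/setP => i; rewrite !inE.
have Sj : {in S, forall i : 'I_n, (i < j)%N}.
  by move=> i iS; apply: Sc; rewrite ?mem_head.
have Bj : {in B, forall i : 'I_n, (i < j)%N}.
  by move=> i iB; apply: Bc; rewrite ?mem_head.
have restrU (V : {set 'I_n}) : {in V, forall i : 'I_n, (i < j)%N} ->
    restr x (V :|: [set j]) = rcons (restr x V) (tnth x j).
  move=> Vj; rewrite /restr enum_setU_lt ?enum_set1 ?map_cat ?cats1 //.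
  by move=> i k iV /set1P->; apply: Vj.
have restr0 : restr x set0 = [::] by rewrite /restr enum_set0.
rewrite (bigID (fun P => j \in pblock P i0)) /=; congr (_ + _).
  under eq_bigl do rewrite -andbA.
  rewrite pivot_step //; last by move=> i; rewrite inE => /jc.
  rewrite IHc //; first 1 last.
  - by rewrite inE i0S.
  - by move=> i k _; rewrite inE.
  - by move=> i k; rewrite !inE => /orP[iS|/eqP->] kc;
      [apply: Sc; rewrite // inE kc orbT|apply: jc].
  - by move=> i k; rewrite inE.
  by rewrite restr0; congr (_ * _); apply: eq_gap_sum => // v; rewrite restrU // cat_rcons.
rewrite -restrU // -IHc //; first 1 last.
- by move=> i k iS; rewrite !inE => /orP[/(SB _ _ iS) //|/eqP->]; apply: Sj.
- by move=> i k iS kc; apply: Sc; rewrite // inE kc orbT.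
- by move=> i k; rewrite !inE => /orP[iB|/eqP->] kc;
    [apply: Bc; rewrite // inE kc orbT|apply: jc].
apply: eq_big => [P|//].
have -> : B :|: (S :|: (j |: [set i in c])) = B :|: [set j] :|: (S :|: [set i in c]).
  by rewrite -!setUA (setUCA S).
rewrite -andbA; congr (_ && _); rewrite /pivot_state -andbA; congr (_ && _).
by rewrite -[RHS]setI_eq0 setIUr setU_eq0 !setI_eq0 [in RHS]andbC
  [X in _ = X && _]disjoint_sym disjoints1 andbC.
Qed.
End State.

(** The first letter is the pivot. Its block is outer, the gaps between its letters contain inner
    blocks only, and the blocks after its last letter keep their own status. *)
Lemma nc_moment_cons fi fo a w : nc_moment fi fo (a :: w) =
  gap_sum (nc_moment fi fi) (nc_moment fi fo) (fun v => fo (a :: v)) [::] w.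
Proof.
pose x : (size w).+1.-tuple T := in_tuple (a :: w).
pose c := [seq lift ord0 i | i <- enum 'I_(size w)].
have ec : enum 'I_(size w).+1 = ord0 :: c by rewrite enum_ordSl.
have := sorted_enum [set: 'I_(size w).+1].
rewrite enum_setT -enumT ec /= (path_sortedE (@ord_lt_trans _)) => /andP[/allP lt0c c_s].
have := @sum_pivot_state _ x fi fo ord0 c [set ord0] set0 (set11 _).
rewrite /restr enum_set1 enum_set0 /=.
have xc : [seq tnth x i | i <- c] = w.
  by have := map_tnth_enum x; rewrite ec /= => -[].
have -> : tnth x ord0 = a by [].
rewrite xc => <- //; first 1 last.
- by move=> i j _; rewrite inE.
- by move=> i j /set1P-> /lt0c.
- by move=> i j; rewrite inE.
rewrite /nc_moment /nc_sum.
have -> : set0 :|: ([set ord0] :|: [set i in c]) = [set: 'I_(size w).+1].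
  apply/setP => i; rewrite !inE; have := mem_enum 'I_(size w).+1 i.
  by rewrite ec inE.
apply: eq_bigl => P; case PT: (P \in _) => //=.
have /NCinP[/and3P[/eqP cP _ _] _] := PT.
by rewrite /pivot_state sub1set mem_pblock cP inE -setI_eq0 setI0 eqxx.
Qed.
End NCSum.

(** * Rotation of non-crossing partitions *)

Section Rotation.
Variable m : nat.
Local Notation n := m.+1.
Implicit Types (V : {set 'I_n}) (P : {set {set 'I_n}}).

Lemma ordS_val (i : 'I_n) : ordS i = (if i == ord_max then 0 else i.+1)%N :> nat.
Proof.
rewrite /= -val_eqE /=; case: eqP => [->|/eqP im]; first by rewrite modnn.
by rewrite modn_small // ltn_neqAle eqSS im ltn_ord.
Qed.

Lemma ordS_homo (i j : 'I_n) : j != ord_max -> (i < j)%N -> (ordS i < ordS j)%N.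
Proof.
move=> jm ij; rewrite !ordS_val (negPf jm); case: eqP => // im.
Qed.

Lemma noncrossing_ordS P : noncrossing P -> noncrossing (imblocks (@ordS n) P).
Proof.
move=> /noncrossingP nc; apply/noncrossingP => V W a b c d.
move=> /imsetP[{}V VP ->] /imsetP[{}W WP ->] VW.
have {}VW : V != W by apply: contra_neq VW => ->.
move=> /imsetP[{}a aV ->] /imsetP[{}b bW ->] /imsetP[{}c cV ->] /imsetP[{}d dW ->].
rewrite !ordS_val; case: (d =P ord_max) => // /eqP dm; case: (c =P ord_max) => // _.
case: (b =P ord_max) => // _; rewrite !ltnS; case: (a =P ord_max) => [am|_] ab bc cd.
  (* Here [a] is the last position, sent to the front by the shift; before the shift it follows [d],
     and the two blocks exchange their roles. *)
  apply: (nc W V b c d a) => //; first by rewrite eq_sym.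
  by rewrite am ltn_neqAle -ltnS ltn_ord andbT.
by apply: (nc V W a b c d).
Qed.

(** The shift is injective and preserves non-crossing partitions; surjectivity follows by
    counting. *)
Lemma imblocks_ordS_NCin : imblocks (@ordS n) @: NCin setT = NCin setT.
Proof.
have h_inj := @ordS_inj n; apply/eqP; rewrite eqEcard.
rewrite card_imset ?leqnn ?andbT; last exact: imblocks_inj.
apply/subsetP => _ /imsetP[P /NCinP[PT nc] ->]; apply/NCinP.
split; last exact: noncrossing_ordS.
have -> : [set: 'I_n] = @ordS n @: setT.
  by apply/esym/eqP; rewrite eqEcard subsetT card_imset /=.
by rewrite partition_imblocks.
Qed.

(** Only the last position wraps around. If it is outside [V], the shift is increasing on [V];
    otherwise its letter passes from the end of the subword to the front. *)
Lemma restr_rot1 (T : Type) (x : n.-tuple T) V :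
  restr (rot_tuple 1 x) V = restr x (@ordS n @: V) \/
  restr (rot_tuple 1 x) V = rot 1 (restr x (@ordS n @: V)).
Proof.
have yx i : tnth (rot_tuple 1 x) i = tnth x (ordS i).
  rewrite !(tnth_nth (thead x)) ordS_val /=.
  case: x => -[|a s] //= sz; rewrite rot1_cons nth_rcons.
  have szE : size s = m by case/eqP: (sz).
  rewrite -val_eqE szE /=; case: ltngtP => //= mi.
  by have := ltn_ord i; rewrite ltnS leqNgt mi.
have -> : restr (rot_tuple 1 x) V = map (tnth x) (map (@ordS n) (enum V)).
  by rewrite -map_comp; apply: eq_map => i; rewrite yx.
have [mV|mV] := boolP (ord_max \in V); last first.
  left; rewrite /restr enum_imset_homo // => i j _ jV; apply: ordS_homo.
  by apply: contraNneq mV => <-.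
right; have VE : V = V :\ ord_max :|: [set ord_max] by rewrite setUC setD1K.
have ltm (i : 'I_n) : i \in V :\ ord_max -> (i < m)%N.
  by rewrite !inE -val_eqE /= => /andP[im _]; rewrite ltn_neqAle im -ltnS ltn_ord.
rewrite {1}VE enum_setU_lt => [|i j /ltm im /set1P->] //; rewrite enum_set1.
have hm : @ordS n ord_max = ord0 by apply: val_inj; rewrite [LHS]ordS_val eqxx.
rewrite /restr {2}VE imsetU imset_set1 setUC enum_setU_lt; last first.
  move=> _ _ /set1P-> /imsetP[i /ltm im ->]; rewrite hm ordS_val.
  by rewrite -val_eqE /= (ltn_eqF im).
rewrite enum_imset_homo; last first.
  move=> i j _ /ltm jm; apply: ordS_homo.
  by rewrite -val_eqE /= (ltn_eqF jm).
by rewrite enum_set1 hm map_cat /= rot1_cons -cats1 map_cat hm.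
Qed.

(** The one-block partition is left out so that the invariance of [f] is required on words shorter
    than [n] only, as suits the induction in [nc_moment_rot1_inv]. *)
Lemma sum_rot1 (K : comNzRingType) (T : Type) (f : seq T -> K) (x : n.-tuple T) :
  (forall s, (size s < n)%N -> f (rot 1 s) = f s) ->
  \sum_(P in NCin setT | P != [set setT])
     \prod_(V in P) f (restr (rot_tuple 1 x) V) =
  \sum_(P in NCin setT | P != [set setT]) \prod_(V in P) f (restr x V).
Proof.
move=> fr; have h_inj := @ordS_inj n.
have hT : @ordS n @: setT = setT.
  by apply/eqP; rewrite eqEcard subsetT card_imset /=.
have h1 : imblocks (@ordS n) [set setT] = [set setT] by rewrite /imblocks imset_set1 hT.
rewrite [RHS](eq_bigl (fun P => (P \in imblocks (@ordS n) @: NCin setT) &&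
  (P != [set setT]))); last first.
  by move=> P; rewrite imblocks_ordS_NCin.
rewrite [RHS]big_imset_cond /=; last by move=> P P' _ _; apply: imblocks_inj.
apply: eq_big => [P|P /andP[PN PT]].
  by rewrite -{2}h1 (inj_eq (imblocks_inj h_inj)).
rewrite big_imblocks //; apply: eq_bigr => V VP.
have [-> //|->] := restr_rot1 x V; apply: fr.
rewrite size_restr card_imset //.
exact: (block_lt NC_part PN PT VP).
Qed.
End Rotation.

Section RotMoment.
Variables (K : comNzRingType) (T : Type).
Implicit Types (f : seq T -> K).

Lemma nc_moment_full f n (x : n.+1.-tuple T) : nc_moment f f x =
  f x + \sum_(P in NCin setT | P != [set setT]) \prod_(V in P) f (restr x V).
Proof.
rewrite nc_momentE /nc_sum (bigD1 [set setT]) /=; last exact: NC_full.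
rewrite {1}/block_weight big_set1 if_same restr_setT; congr (_ + _).
by apply: eq_bigr => P _; apply: eq_bigr => V _; rewrite if_same.
Qed.

Lemma nc_moment_rot1 f w : (forall s, f (rot 1 s) = f s) ->
  nc_moment f f (rot 1 w) = nc_moment f f w.
Proof.
case: w => [|a w] fr; first by [].
have := nc_moment_full f (rot_tuple 1 (in_tuple (a :: w))).
rewrite sum_rot1 // => ->; rewrite fr.
by rewrite -(nc_moment_full f (in_tuple (a :: w))).
Qed.

(** Strong induction on the length: [f s] is the moment minus terms in shorter words, whose sum is
    unchanged by rotation. *)
Lemma nc_moment_rot1_inv f :
    (forall w, nc_moment f f (rot 1 w) = nc_moment f f w) ->
  forall s, f (rot 1 s) = f s.
Proof.
move=> Mr s; have [m] := ubnP (size s); elim: m s => // m IHm [|a s] sm //.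
have := nc_moment_full f (rot_tuple 1 (in_tuple (a :: s))).
rewrite sum_rot1 => [|t ts]; last by apply: IHm; apply: leq_trans ts _.
by rewrite Mr (nc_moment_full f (in_tuple (a :: s))) => /addIr.
Qed.
End RotMoment.

(** * Boolean cumulants from c-free cumulants *)

(* Hence a Boolean moment is an [nc_moment] whose inner blocks have weight 0. *)
Lemma interval_partitionE n (P : {set {set 'I_n}}) :
  (P \in interval_partition n) =
  (P \in NCin setT) && [forall V in P, ~~ covered P V].
Proof.
apply/idP/idP.
  rewrite inE => /andP[PT /forall_inP itv].
  have [_ tP _] := and3P PT.
  have btw V a (b : 'I_n) c : V \in P -> a \in V -> c \in V -> (a <= b <= c)%N -> b \in V.
    move=> VP aV cV; move/forall_inP: (itv V VP) => /(_ a aV) /forall_inP /(_ c cV).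
    by move=> /forallP/(_ b)/implyP.
  have eqb V W (b : 'I_n) : V \in P -> W \in P -> b \in V -> b \in W -> V = W.
    by move=> VP WP bV bW; rewrite -(def_pblock tP VP bV) (def_pblock tP WP bW).
  apply/andP; split.
    apply/NCinP; split=> //; apply/noncrossingP.
    move=> V W a b c d VP WP /eqP VW aV bW cV dW ab bc _; apply: VW.
    by apply: (eqb V W b) => //; apply: (btw V a b c); rewrite ?(ltnW ab) ?(ltnW bc).
  apply/forall_inP => V VP; apply/negP => /exists_inP[W WP].
  case/nestedP=> a [b [aW bW VW]].
  have /set0Pn[v vV] := block_neq0 PT VP.
  have /andP[av vb] := VW v vV.
  have vW : v \in W by apply: (btw W a v b); rewrite ?(ltnW av) ?(ltnW vb).
  move: aW; rewrite -(eqb V W v) // => /VW.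
  by rewrite ltnn.
case/andP => /NCinP[PT nc] /forall_inP ncov; rewrite inE PT /=.
have [/eqP cP tP _] := and3P PT.
apply/forall_inP => V VP; apply/forall_inP => a aV; apply/forall_inP => c cV.
apply/forallP => b; apply/implyP => /andP[ab bc]; apply: contraT => bV.
have bP : b \in cover P by rewrite cP inE.
have WP := pblock_mem bP; have bW : b \in pblock P b by rewrite mem_pblock.
have WV : pblock P b != V by apply: contraNneq bV => <-.
have {}ab : (a < b)%N by rewrite ltn_neqAle ab andbT; apply: contraNneq bV => /val_inj<-.
have {}bc : (b < c)%N by rewrite ltn_neqAle bc andbT; apply: contraNneq bV => /val_inj->.
(* The block of [b] cannot leave the interval from [a] to [c] without crossing [V], so [V] covers
   it. *)
case/negP: (ncov _ WP); apply/exists_inP; exists V => //; apply/nestedP.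
exists a, c; split=> // d dW.
have dV : d \notin V.
  apply: contra WV => dV.
  by rewrite -(def_pblock tP WP dW) (def_pblock tP VP dV).
apply/andP; split; rewrite ltnNge; apply/negP => h.
  have da : (d < a)%N by rewrite ltn_neqAle h andbT; apply: contraNneq dV => /val_inj->.
  exact: (noncrossingP _ nc _ _ d a b c WP VP WV).
have cd : (c < d)%N by rewrite ltn_neqAle h andbT; apply: contraNneq dV => /val_inj<-.
by apply: (noncrossingP _ nc V (pblock P b) a b c d) => //; rewrite eq_sym.
Qed.

Section Boolean.
Variables (K : comNzRingType) (T : Type).
Implicit Types (f fi fo kap kapc M N : seq T -> K).

Lemma eq_nc_moment fi fi' fo fo' w : fi =1 fi' -> fo =1 fo' ->
  nc_moment fi fo w = nc_moment fi' fo' w.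
Proof.
move=> Ei Eo; apply: eq_bigr => P _; apply: eq_bigr => V _.
by rewrite Ei Eo.
Qed.

Lemma nc_moment_map U (h : U -> T) fi fo (w : seq U) :
  nc_moment fi fo (map h w) = nc_moment (fi \o map h) (fo \o map h) w.
Proof.
rewrite -[map h w]/(tval (map_tuple h (in_tuple w))) nc_momentE.
apply: eq_bigr => P _; apply: eq_bigr => V _.
by rewrite restr_map.
Qed.

Lemma gap_sum_map U (h : U -> T) M N f acc (w : seq U) :
  gap_sum M N f (map h acc) (map h w) =
  gap_sum (M \o map h) (N \o map h) (f \o map h) acc w.
Proof.
elim: w f acc => [|c w IHw] f acc //=.
by rewrite -map_rcons IHw -[[::]]/(map h [::]) IHw.
Qed.

Lemma sum_interval f n (x : n.-tuple T) :
  \sum_(P in interval_partition n) \prod_(V in P) f (restr x V) =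
  nc_moment (fun=> 0) f x.
Proof.
rewrite nc_momentE /nc_sum (eq_bigl _ _ (@interval_partitionE n)).
rewrite big_mkcondr; apply: eq_bigr => P _; case: ifPn => [/forall_inP ncov|].
  by apply: eq_bigr => V VP; rewrite (negPf (ncov V VP)).
rewrite negb_forall_in => /exists_inP[V VP /negbNE cV].
by rewrite /block_weight (bigD1 V) //= cV mul0r.
Qed.

(* With [is_nil] as its argument [N], [gap_sum] only keeps the decompositions
   whose last gap is empty. *)
Definition is_nil (g : seq T) : K := (nilp g)%:R.

Lemma nc_moment_nil fi fo : nc_moment fi fo [::] = 1.
Proof.
rewrite /nc_moment /nc_sum (big_pred1 set0) => [|P] /=.
  by rewrite /block_weight big_set0.
apply/NCinP/eqP => [[PT _]|->]; last first.
  split; last by apply/noncrossingP => V W a b c d; rewrite inE.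
  apply/and3P; split; rewrite ?inE //; last by apply/trivIsetP => V W; rewrite inE.
  by apply/eqP/setP => -[].
apply/setP => V; rewrite inE; apply/negP => /(block_neq0 PT).
by case/set0Pn => -[].
Qed.

Lemma gap_sum0 M N f acc w : (forall v, f v = 0) -> gap_sum M N f acc w = 0.
Proof.
elim: w f acc => [|c w IHw] f acc f0 /=; first by rewrite f0 mul0r.
by rewrite !IHw ?mulr0 ?addr0.
Qed.

Lemma nc_moment0 w : nc_moment (fun=> 0) (fun=> 0) w = is_nil w.
Proof.
by case: w => [|a w]; rewrite ?nc_moment_nil // nc_moment_cons gap_sum0.
Qed.

(** Cut [w] after the last letter taken into the block: what precedes has an empty last gap, and [N]
    receives the rest. The first summand is the case where no letter is taken and [acc] is nonempty,
    so that the last gap is all of [acc ++ w]. *)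
Lemma gap_sum_split M N f acc w :
  gap_sum M N f acc w = f [::] * (1 - is_nil acc) * N (acc ++ w) +
  \sum_(j < (size w).+1) gap_sum M is_nil f acc (take j w) * N (drop j w).
Proof.
elim: w f acc => [|c w IHw] f acc.
  rewrite big_ord1 /= cats0; case: acc => [|a acc]; rewrite /is_nil /=.
    by rewrite subrr mulr0 mul0r add0r mulr1.
  by rewrite subr0 mulr0 mul0r addr0 mulr1.
rewrite big_ord_recl /= !IHw.
set S1 := \sum_(j < _) gap_sum _ _ (fun v => f (c :: v)) _ _ * _.
set S2 := \sum_(j < _) gap_sum _ _ f (rcons acc c) _ * _.
have -> : \sum_(i < (size w).+1)
    (M acc * gap_sum M is_nil (fun v => f (c :: v)) [::] (take (0 + i) w) +
      gap_sum M is_nil f (rcons acc c) (take (0 + i) w)) * N (drop (0 + i) w) =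
    M acc * S1 + S2.
  by rewrite mulr_sumr -big_split; apply: eq_bigr => i _; rewrite mulrDl mulrA.
have -> : is_nil (rcons acc c) = 0 by case: (acc).
rewrite cat_rcons [is_nil [::]]/(1%:R).
by case: acc {IHw} @S1 @S2 => [|a acc] S1 S2; rewrite /is_nil /=; ring.
Qed.

Lemma gap_sum_nil f w acc :
  gap_sum is_nil is_nil f acc w = is_nil acc * f w.
Proof.
elim: w f acc => [|c w IHw] f acc /=; first by rewrite mulrC.
rewrite !IHw /is_nil /= mul1r.
by case: acc => [|a acc] /=; rewrite !mul0r addr0.
Qed.

(* The Boolean cumulants in terms of the free and c-free ones: sum over the
   non-crossing partitions in which the first and last letters share a block. *)
Definition boolean_of kap kapc (s : seq T) : K :=
  if s is a :: w then
    gap_sum (nc_moment kap kap) is_nil (fun v => kapc (a :: v)) [::] w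
  else 0.

(** Cut both sides after the last letter of the first block. On the left the inner weight 0 leaves
    only empty gaps; on the right the sum up to the cut is [boolean_of] by definition. The tails
    agree by induction. *)
Lemma nc_moment_boolean_of kap kapc w :
  nc_moment (fun=> 0) (boolean_of kap kapc) w = nc_moment kap kapc w.
Proof.
have [m] := ubnP (size w); elim: m w => // m IHm [|a w] wm.
  by rewrite !nc_moment_nil.
rewrite !nc_moment_cons gap_sum_split [RHS]gap_sum_split.
rewrite [is_nil [::]]/(1%:R) subrr !mulr0 !mul0r !add0r.
apply: eq_bigr => j _; rewrite IHm; last first.
  by rewrite size_drop; apply: leq_ltn_trans (leq_subr _ _) _.
congr (_ * _).
rewrite (eq_gap_sum (M' := is_nil) (N' := is_nil)
  (f' := fun v => boolean_of kap kapc (a :: v))) //.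
  by rewrite gap_sum_nil mul1r.
exact: nc_moment0.
Qed.

(** An empty last gap forces [b] into the block, and the gap just before [b] becomes an ordinary
    one, weighted by [M]. *)
Lemma gap_sum_rcons M f acc w b :
  gap_sum M is_nil f acc (rcons w b) = gap_sum M M (fun v => f (rcons v b)) acc w.
Proof.
elim: w f acc => [|c w IHw] f acc /=; last by rewrite !IHw.
by rewrite /is_nil; case: acc => [|a acc]; rewrite /= mulr0 addr0 mulr1 mulrC.
Qed.

Lemma boolean_of_rcons kap kapc a w b : boolean_of kap kapc (a :: rcons w b) =
  gap_sum (nc_moment kap kap) (nc_moment kap kap)
    (fun v => kapc (a :: rcons v b)) [::] w.
Proof. exact: gap_sum_rcons. Qed.
End Boolean.

(** * Non-crossing partitions with a marked letter *)

Section CyclicSum.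
Variables (K : comNzRingType) (T : Type).

Definition cyclic_sum (F : seq T -> K) (s : seq T) : K :=
  \sum_(p < size s) F (rot p s).

Lemma cyclic_sum_rot1 F s : cyclic_sum F (rot 1 s) = cyclic_sum F s.
Proof.
case: s => [|a s]; first by [].
rewrite /cyclic_sum size_rot big_ord_recr [RHS]big_ord_recl /= addrC.
have rotE p : (p <= size s)%N -> rot p (rot 1 (a :: s)) = rot p.+1 (a :: s).
  by move=> ps; rewrite rot_rot -rotS.
congr (_ + _); last by apply: eq_bigr => p _; rewrite rotE // ltnW.
by rewrite rotE // -[(size s).+1]/(size (a :: s)) rot_size rot0.
Qed.
End CyclicSum.

Section Marks.
Variables (K : comNzRingType) (T : Type) (kap F : seq T -> K).
Hypothesis kap_rot1 : forall s, kap (rot 1 s) = kap s.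

Definition unmarked (t : T) := (t, false).

(* Marking one letter of a word lets a single weight, still invariant under
   rotation, treat the block of that letter differently from the others. *)
Definition head_marked (s : seq (T * bool)) : K :=
  if s is (_, true) :: _ then F (map fst s) else 0.

(** On a word with exactly one mark, the cyclic sum keeps only the rotation starting at the mark. *)
Definition marked_weight (s : seq (T * bool)) : K :=
  cyclic_sum head_marked s + (if has snd s then 0 else kap (map fst s)).

Lemma marked_weight_rot1 s : marked_weight (rot 1 s) = marked_weight s.
Proof.
by rewrite /marked_weight cyclic_sum_rot1 has_rot map_rot kap_rot1.
Qed.

Lemma nc_moment_marked_rot q w :
  nc_moment marked_weight marked_weight (rot q w) =
  nc_moment marked_weight marked_weight w.
Proof.
have [qw|] := leqP q (size w); last by move=> /ltnW wq; rewrite rot_oversize.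
elim: q qw => [|q IHq] qw; first by rewrite rot0.
by rewrite rotS // nc_moment_rot1 ?IHq ?(ltnW qw) //; apply: marked_weight_rot1.
Qed.

Lemma head_marked_rot t0 p s : (p < size s)%N -> head_marked (rot p s) =
  if (nth t0 s p).2 then F (rot p (map fst s)) else 0.
Proof.
move=> ps; rewrite -map_rot /rot (drop_nth t0) //=.
by case: (nth t0 s p) => t [].
Qed.

Lemma marked_weight_unmarked v : marked_weight (map unmarked v) = kap v.
Proof.
rewrite /marked_weight /cyclic_sum big1 => [|p _]; last first.
  by rewrite -map_rot; case: (rot p v).
rewrite has_map (eq_has (a2 := pred0)) // has_pred0 add0r -map_comp.
by rewrite map_id.
Qed.

Lemma marked_weight_cons a v :
  marked_weight ((a, true) :: map unmarked v) = F (a :: v).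
Proof.
rewrite /marked_weight /= addr0 /cyclic_sum big_ord_recl rot0 /= -map_comp map_id.
rewrite big1 ?addr0 // => p _.
have pv : (p < size v)%N by rewrite -(size_map unmarked v).
rewrite (head_marked_rot (unmarked a)) ?size_map //= ?size_map //.
by rewrite (nth_map a).
Qed.

Lemma nc_moment_marked_cons a w :
  nc_moment marked_weight marked_weight ((a, true) :: map unmarked w) =
  gap_sum (nc_moment kap kap) (nc_moment kap kap) (fun v => F (a :: v)) [::] w.
Proof.
rewrite nc_moment_cons -[[::]]/(map unmarked [::]) gap_sum_map.
have E g : nc_moment marked_weight marked_weight (map unmarked g) = nc_moment kap kap g.
  by rewrite nc_moment_map; apply: eq_nc_moment => v; apply: marked_weight_unmarked.
by apply: eq_gap_sum => v; [apply: E | apply: E | apply: marked_weight_cons].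
Qed.

Definition mark n (x : n.-tuple T) (q : 'I_n) : n.-tuple (T * bool) :=
  [tuple (tnth x i, i == q) | i < n].

Lemma rot_mark n (x : n.-tuple T) (q : 'I_n) :
  rot q (mark x q) =
  (tnth x q, true) :: map unmarked (drop q.+1 x ++ take q x).
Proof.
have qx : (q < size (mark x q))%N by rewrite size_tuple.
have nthE t0 i : (i < n)%N ->
    nth (t0, true) (mark x q) i = (nth t0 x i, i == q :> nat).
  by move=> i_n; have := tnth_mktuple (fun i => (tnth x i, i == q)) (Ordinal i_n);
    rewrite !(tnth_nth (t0, true)) (tnth_nth t0).
rewrite /rot (drop_nth (tnth x q, true)) // nthE ?ltn_ord // eqxx -tnth_nth map_cat.
congr (_ :: (_ ++ _)); apply: (@eq_from_nth _ (tnth x q, true)).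
- by rewrite size_map !size_drop !size_tuple.
- move=> i; rewrite size_drop size_tuple => iq.
  have iq' : (q.+1 + i < n)%N by rewrite -ltn_subRL.
  rewrite nth_drop (nth_map (tnth x q)) ?size_drop ?size_tuple // nth_drop nthE //.
  by rewrite /unmarked addSn gtn_eqF // ltnS leq_addr.
- by rewrite size_map !size_take !size_tuple.
move=> i; rewrite size_take size_tuple ltn_ord => iq.
rewrite nth_take // (nth_map (tnth x q)) ?size_take ?size_tuple ?ltn_ord //.
by rewrite nth_take // nthE ?(ltn_trans iq) // /unmarked ltn_eqF.
Qed.

(** With the mark at [q], only the rotation starting at [q] survives, so letting [q] run over [V]
    produces every rotation once. *)
Lemma sum_marked_weight n (x : n.-tuple T) (V : {set 'I_n}) :
  \sum_(q in V) marked_weight (restr (mark x q) V) = cyclic_sum F (restr x V).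
Proof.
have E q : q \in V -> marked_weight (restr (mark x q) V) =
    \sum_(p < size (restr x V))
      if nth q (enum V) p == q then F (rot p (restr x V)) else 0.
  move=> qV; have hq : has snd (restr (mark x q) V).
    rewrite has_map; apply/hasP; exists q; first by rewrite mem_enum.
    by rewrite /= tnth_mktuple eqxx.
  rewrite /marked_weight hq addr0 /cyclic_sum !size_restr; apply: eq_bigr => p _.
  rewrite (head_marked_rot (tnth (mark x q) q)) ?size_restr //.
  rewrite (nth_map q) -?cardE // tnth_mktuple /=; congr (if _ then F (rot _ _) else _).
  by rewrite /restr -map_comp; apply: eq_map => i; rewrite /= tnth_mktuple.
rewrite (eq_bigr _ E) exchange_big; apply: eq_bigr => p _ /=.
have pV : (p < size (enum V))%N by rewrite -cardE -(size_restr x).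
have [q0 _] : exists q0, q0 \in V.
  by apply/set0Pn; rewrite -card_gt0 cardE; apply: leq_ltn_trans pV.
have iV : nth q0 (enum V) p \in V by rewrite -mem_enum mem_nth.
rewrite (bigD1 (nth q0 (enum V) p)) //= (set_nth_default q0) // eqxx big1 ?addr0 //.
move=> q /andP[qV /negPf qp]; rewrite (set_nth_default q0) //.
by rewrite eq_sym qp.
Qed.

(** The marks are grouped by the block [V0] that contains them; all other blocks are unmarked and
    weigh [kap]. *)
Lemma sum_nc_moment_mark n (x : n.-tuple T) :
  \sum_(q < n) nc_moment marked_weight marked_weight (mark x q) =
  \sum_(P in NC n) \sum_(V0 in P)
    cyclic_sum F (restr x V0) * \prod_(V in P | V != V0) kap (restr x V).
Proof.
under eq_bigr do rewrite nc_momentE.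
rewrite exchange_big; apply: eq_bigr => P /NCinP[PT _] /=.
have [/eqP cP tP _] := and3P PT.
rewrite -(eq_bigl _ _ (in_setT (T := 'I_n))) (set_partition_big _ PT).
apply: eq_bigr => V0 V0P; rewrite -sum_marked_weight mulr_suml.
apply: eq_bigr => q qV0; rewrite /block_weight (bigD1 V0) //= if_same.
congr (_ * _); apply: eq_bigr => V /andP[VP VV0]; rewrite if_same.
have -> : restr (mark x q) V = map unmarked (restr x V).
  rewrite /restr -map_comp; apply/eq_in_map => i; rewrite mem_enum => iV.
  rewrite tnth_mktuple /= /unmarked; congr (_, _); apply/negbTE.
  apply: contra_neq VV0 => iq.
  by rewrite -(def_pblock tP VP iV) iq (def_pblock tP V0P qV0).
exact: marked_weight_unmarked.
Qed.
End Marks.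

(** The argument of the Boolean cumulants in [Psi]: once around the word, the letter at [p] standing
    at both ends. *)
Definition loop (T : Type) (s : seq T) (p : nat) := drop p s ++ take p.+1 s.

Section Loop.
Variable T : Type.
Implicit Types s : seq T.

Lemma loopE a s p : (p < size s)%N -> loop s p = rcons (rot p s) (nth a s p).
Proof. by move=> ps; rewrite /loop (take_nth a) // /rot rcons_cat. Qed.

Lemma loop_map U (h : T -> U) s p :
  loop (map h s) p = map h (loop s p).
Proof. by rewrite /loop -map_drop -map_take map_cat. Qed.

Lemma size_loop s p : (p < size s)%N -> size (loop s p) = (size s).+1.
Proof. by case: s => // a s ps; rewrite (loopE a) // size_rcons size_rot. Qed.

Lemma has_loop (a : pred T) s p : (p < size s)%N -> has a s -> has a (loop s p).
Proof.
by case: s => // b s ps h; rewrite (loopE b) // has_rcons has_rot h orbT.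
Qed.
End Loop.

Lemma sum_boolean_of_loop (K : comNzRingType) (T : Type) (kap kapc : seq T -> K)
    n (x : n.-tuple T) : (forall s, kap (rot 1 s) = kap s) ->
  \sum_(q < n) boolean_of kap kapc (loop x q) =
  \sum_(P in NC n) \sum_(V0 in P)
    (\sum_(p < size (restr x V0)) kapc (loop (restr x V0) p)) *
    \prod_(V in P | V != V0) kap (restr x V).
Proof.
(* [F] repeats the first letter at the end, so that one marked letter stands for both ends of a
   loop. *)
move=> kr; pose F (s : seq T) := if s is a :: _ then kapc (rcons s a) else 0.
transitivity (\sum_(P in NC n) \sum_(V0 in P)
    cyclic_sum F (restr x V0) * \prod_(V in P | V != V0) kap (restr x V)).
  rewrite -sum_nc_moment_mark; apply: eq_bigr => q _.
  (* Rotation invariance brings the mark to the front; the marked block is then the first one, as in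
     [boolean_of]. *)
  rewrite -(nc_moment_marked_rot F kr q) rot_mark (nc_moment_marked_cons kap F).
  rewrite (loopE (tnth x q)) ?size_tuple // -tnth_nth /rot.
  rewrite (drop_nth (tnth x q)) ?size_tuple // -tnth_nth.
  by rewrite cat_cons rcons_cons boolean_of_rcons.
apply: eq_bigr => P _; apply: eq_bigr => V0 _; congr (_ * _).
apply: eq_bigr => p _; case E : (restr x V0) p => [|a s] p; first by case: p.
by rewrite (loopE a) // /rot (drop_nth a).
Qed.

(** * Cumulants of the indeterminates *)

Section WordCumulants.
Variables (R : realType) (k : nat).
Implicit Types (mu nu : Dalg R k) (w : seq 'I_k).
Local Notation X := (map (@ncX R k)).
Local Notation kap mu := (free_cumulant mu \o X).
Local Notation kapc mu nu := (cfree_cumulant mu nu \o X).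

Lemma free_moment_words mu w :
  mu (\prod_(i <- w) ncX R i) = nc_moment (kap mu) (kap mu) w.
Proof.
case: w => [|a w]; first by rewrite big_nil nc_moment_nil Dalg_fun1.
have := (free_cumulantP mu).2 _ (map_tuple (@ncX R k) (in_tuple (a :: w))) isT.
rewrite big_map => ->; apply: eq_bigr => P _; apply: eq_bigr => V _.
by rewrite if_same restr_map.
Qed.

Lemma cfree_moment_words mu nu w :
  nu (\prod_(i <- w) ncX R i) = nc_moment (kap mu) (kapc mu nu) w.
Proof.
case: w => [|a w]; first by rewrite big_nil nc_moment_nil Dalg_fun1.
have := (cfree_cumulantP mu nu).2 _ (map_tuple (@ncX R k) (in_tuple (a :: w))) isT.
rewrite big_map => ->; apply: eq_bigr => P /NCinP[PT _].
rewrite /block_weight [RHS](bigID (inner P)) /=; congr (_ * _).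
  by apply: eq_bigr => V /andP[VP]; rewrite (innerE PT VP) => ->; rewrite restr_map.
by apply: eq_bigr => V /andP[VP]; rewrite (innerE PT VP) => /negPf->; rewrite restr_map.
Qed.

(** By uniqueness of Boolean cumulants: the interval sum of [boolean_of] equals the c-free sum,
    which gives the moments of [nu], for any choice of [mu]. *)
Lemma boolean_cumulant_words mu nu w : (0 < size w)%N ->
  boolean_cumulant nu (X w) = boolean_of (kap mu) (kapc mu nu) w.
Proof.
have /(is_booleanE _ _ (fun=> 0))[_ /(cumeq_map (@ncX R k)) E] := boolean_cumulantP nu.
move: w; apply: (cumeq_uniq interval_part interval_full _ _ _ E) => //.
move=> n x n0 /=; rewrite big_map (cfree_moment_words mu) -nc_moment_boolean_of.
by rewrite -sum_interval; apply: eq_bigr => P _; apply/esym/term_freeE.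
Qed.

(** Traciality makes the moments rotation invariant, and this descends to the cumulants by
    inversion. *)
Lemma tracial_cumulant_rot1 mu s : tracial mu -> kap mu (rot 1 s) = kap mu s.
Proof.
move=> tr; move: s; apply: nc_moment_rot1_inv => -[|a w] //.
rewrite -!free_moment_words rot1_cons -cats1 big_cat big_seq1 big_cons /=.
exact: tr.
Qed.

(** By uniqueness of infinitesimal cumulants, it suffices that the loop sums of c-free cumulants
    satisfy the moment formula of [Psi nu], which is [sum_boolean_of_loop]. *)
Lemma inf_cumulant_Psi mu nu w : (forall s, kap mu (rot 1 s) = kap mu s) ->
  (0 < size w)%N -> inf_cumulant mu (Psi nu) (X w) =
  \sum_(p < size w) cfree_cumulant mu nu (X (loop w p)).
Proof.
move=> kr; have /is_infE[_ /(cumeq_map (@ncX R k)) E] := inf_cumulantP mu (Psi nu).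
move: w; apply: (cumeq_uniq NC_part NC_full _ _ _ E) => //.
  by move=> n _; apply: eqxx.
move=> n x n0 /=; rewrite big_map PsiP ?size_tuple //.
under [RHS]eq_bigr do rewrite term_infE.
rewrite -(sum_boolean_of_loop (kapc mu nu) x kr); apply: eq_bigr => q _.
by rewrite (boolean_cumulant_words mu) // size_loop ?size_tuple.
Qed.
End WordCumulants.

(** * Rotations and loops in free products *)

Lemma pmap_rot1 (T U : Type) (f : T -> option U) s :
  pmap f (rot 1 s) = pmap f s \/ pmap f (rot 1 s) = rot 1 (pmap f s).
Proof.
case: s => [|a s]; first by left.
rewrite rot1_cons -cats1 pmap_cat /=; case: (f a) => [b|]; last by left; rewrite cats0.
by right; rewrite /= rot1_cons cats1.
Qed.

Section Product.
Variables (R : realType) (k l : nat).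

(** Rotation preserves the set of letters, so a word stays in one factor or stays mixed; within a
    factor the cumulants are invariant by traciality. *)
Lemma free_product_cumulant_rot1 (mu1 : Dalg R k) (mu2 : Dalg R l) mu s :
  tracial mu1 -> tracial mu2 -> is_free_product mu1 mu2 mu ->
  free_cumulant mu (map (@ncX R _) (rot 1 s)) = free_cumulant mu (map (@ncX R _) s).
Proof.
move=> tr1 tr2 /glueP muE; case: s => [|a s] //.
rewrite !muE ?size_rot // /glue has_rot.
have -> p : all p (rot 1 (a :: s)) = all p (a :: s).
  by apply: eq_all_r; apply: mem_rot.
case: ifP => _; last case: ifP => // _.
  set f := (X in pmap X); have [->|->] := pmap_rot1 f (a :: s) => //.
  exact: (tracial_cumulant_rot1 (pmap f (a :: s)) tr1).
set f := (X in pmap X); have [->|->] := pmap_rot1 f (a :: s) => //.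
exact: (tracial_cumulant_rot1 (pmap f (a :: s)) tr2).
Qed.

(** A loop uses the same letters as its word, so each summand of the loop formula inherits its
    value, or its vanishing, from the c-free cumulants. *)
Lemma Psi_cfree_second (mu1 nu1 : Dalg R k) (mu2 nu2 : Dalg R l) nu :
  tracial mu1 -> tracial mu2 -> is_cfree_second mu1 nu1 mu2 nu2 nu ->
  is_inf_second mu1 (Psi nu1) mu2 (Psi nu2) (Psi nu).
Proof.
move=> tr1 tr2 [E1 E2 E0]; set mu := free_product mu1 mu2.
have muE w : (0 < size w)%N -> inf_cumulant mu (Psi nu) (map (@ncX R _) w) =
    \sum_(p < size w) cfree_cumulant mu nu (map (@ncX R _) (loop w p)).
  apply: inf_cumulant_Psi => s; apply: free_product_cumulant_rot1 tr1 tr2 _.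
  exact: free_productP.
split=> [w w0|w w0|w lw rw].
- rewrite (map_comp (@ncX R _)) muE ?size_map // inf_cumulant_Psi //; last first.
    by move=> s; apply: tracial_cumulant_rot1.
  by apply: eq_bigr => p _; rewrite loop_map -map_comp E1 // size_loop.
- rewrite (map_comp (@ncX R _)) muE ?size_map // inf_cumulant_Psi //; last first.
    by move=> s; apply: tracial_cumulant_rot1.
  by apply: eq_bigr => p _; rewrite loop_map -map_comp E2 // size_loop.
have w0 : (0 < size w)%N by case: (w) lw.
by rewrite muE // big1 // => p _; rewrite E0 // has_loop.
Qed.
End Product.

Theorem theorem1p3 (R : realType) (k l : nat) (k_gt0 : (0 < k)%N)
    (l_gt0 : (0 < l)%N) (mu1 nu1 : Dalg R k) (mu2 nu2 : Dalg R l)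
    (tr_mu1 : tracial mu1) (tr_mu2 : tracial mu2)
    (mut nut : Dalg R (k + l))
    (cfree_prod : cfree_product (mu1, nu1) (mu2, nu2) = (mut, nut)) :
  inf_free_product (mu1, Psi nu1) (mu2, Psi nu2) = (mut, Psi nut).
Proof.
have nutE := cfree_productP mu1 nu1 mu2 nu2; rewrite cfree_prod /= in nutE.
have mutE : free_product mu1 mu2 = mut by case: cfree_prod.
rewrite [LHS]surjective_pairing /= mutE; congr (_, _).
(* The second component is determined by its infinitesimal cumulants on words. *)
apply: inf_second_uniq (inf_free_productP _ _ _ _) _.
exact: Psi_cfree_second nutE.
Qed.
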